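(* Let $X=(X(t))_{t\ge 0}$ be a regenerative random process with regeneration epochs $S_k=T_1+\cdots+T_k$, $S_0=0$, and let $\bar X(t)=\sup_{0\le s<t}X(s)$. Let $F(x)=\mathbf{P}(\bar X(T_1)\le x)$ and $R(x)=-\log(1-F(x))$, $x\in\mathbb{R}$. Assume that there exist functions $R_0,R_1:\mathbb{R}\to\mathbb{R}$ such that $R(x)=R_0(x)+R_1(x)$ for all $x\in\mathbb{R}$, such that $|R_1(x)|\le C_1<\infty$ for all $x\in\mathbb{R}$ and some constant $C_1$, and such that $R_0$ satisfies condition $(\mathbb{U})$. Suppose further that $\alpha_T:=\mathbf{E}T_1<\infty$. For large enough $x$ let $r_0(x)=R_0'(x)$ and, for large enough $t$, let $A_0(t)=R_0^{-1}\left(\log\frac{t}{\alpha_T}\right)$. Then $$\limsup_{t\to\infty}\frac{r_0(A_0(t))\,(\bar X(t)-A_0(t))}{\log\log t}=1\quad\text{a.s.}$$ and $$\liminf_{t\to\infty}\frac{r_0(A_0(t))\,(\bar X(t)-A_0(t))}{\log\log\log t}=-1\quad\text{a.s.}$$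
   Context: Regenerative process: $X=(X(t))_{t\ge0}$ is a real-valued random process of the form $X(t)=\xi_k(t-S_{k-1})$ for $t\in[S_{k-1},S_k)$, $k\in\mathbb{N}$, where $S_0=0$, $S_k=T_1+\cdots+T_k$, and $(T_k,\xi_k(\cdot))_{k\in\mathbb{N}}$ is a sequence of independent copies of a pair $(T,\xi(\cdot))$ consisting of a positive random variable $T$ and a random process $\xi(\cdot)$. The interval $[S_{k-1},S_k)$ is the $k$-th period of regeneration, and $\bar X(T_1)=\sup_{0\le s<T_1}X(s)$ is the maximum over the first period. Generalized inverse: for $H:\mathbb{R}\to\mathbb{R}$, $H^{-1}(y)=\inf\{x\in\mathbb{R}:H(x)>y\}$. Regular variation: a positive measurable function $U$ defined in a neighbourhood of $+\infty$ is regularly varying at $+\infty$ with index $\kappa\in\mathbb{R}$ if $U(x)=x^\kappa V(x)$ where $\lim_{t\to+\infty}V(tx)/V(t)=1$ for all $x>0$. Condition $(\mathbb{U})$: a function $H:\mathbb{R}\to\mathbb{R}$ satisfies condition $(\mathbb{U})$ if (1) $\lim_{x\to+\infty}H(x)=+\infty$; (2) $H$ is eventually (i.e. for all sufficiently large arguments) nondecreasing and differentiable; (3) with $h(x)=H'(x)$, the function $\hat h(x)=(H^{-1}(x))'=\frac{1}{h(H^{-1}(x))}$ (for large $x$) is regularly varying at $+\infty$ with some index $\kappa\in\mathbb{R}$. Then $H$ is eventually strictly increasing and, for large arguments, $H^{-1}$ coincides with the usual inverse of $H$ restricted to a neighbourhood of $+\infty$. *)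

(* Defs.v *)
From HB Require Import structures.
From mathcomp Require Import all_boot all_order all_algebra.
From mathcomp Require Import all_classical all_reals all_analysis.
From mathcomp Require Import measurable_realfun.
Set Implicit Arguments.
Unset Strict Implicit.
Unset Printing Implicit Defensive.
Import Order.TTheory GRing.Theory Num.Theory.
Import numFieldNormedType.Exports.
Local Open Scope classical_set_scope.
Local Open Scope ring_scope.

(* Valued in [\bar R]: the supremum of an arbitrary path may be [+oo]. *)
Definition running_sup (R : realType) (x : R -> R) (t : R) : \bar R :=
  ereal_sup [set (x s)%:E | s in `[0, t[].

Definition epoch (R : realType) (Omega : Type) (T : nat -> Omega -> R)
    (k : nat) (w : Omega) : R :=
  \sum_(i < k) T i w.

(* A cycle is a pair (length, path), of which only the values of the path on
   [0, +oo[ matter. The supremum of a path over an uncountable set need not be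
   measurable for the cylindrical sigma-algebra, and cycles that are independent
   or equidistributed for the cylindrical sigma-algebra need not have
   independent or equidistributed suprema. We therefore use the smallest
   sigma-algebra for which the length, the values of the path and the supremum
   of the path over the cycle are all measurable. For cycles with, e.g.,
   right-continuous paths, measurability, independence and equality in law with
   respect to it are the usual ones. *)
Definition cycle_gen (R : realType) : set (set (R * (R -> R))) :=
  preimage_set_system setT (fun c : R * (R -> R) => c.1) measurable
  `|` \bigcup_(s in [set s : R | 0 <= s])
        preimage_set_system setT (fun c : R * (R -> R) => c.2 s) measurable
  `|` preimage_set_system setT
        (fun c : R * (R -> R) => running_sup c.2 c.1) measurable.

Definition cycle_space (R : realType) := g_sigma_algebraType (@cycle_gen R).

Definition regen_cycle (R : realType) (Omega : Type) (T : nat -> Omega -> R)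
    (xi : nat -> R -> Omega -> R) (k : nat) (w : Omega) : cycle_space R :=
  (T k w, fun s => xi k s w).

Definition mutually_independent (R : realType) (d d' : measure_display)
    (Omega : measurableType d) (E : measurableType d')
    (P : probability Omega R) (Y : nat -> Omega -> E) : Prop :=
  forall (J : seq nat) (A : nat -> set E),
    uniq J -> (forall k, measurable (A k)) ->
    P (\bigcap_(k in [set` J]) (Y k @^-1` A k))
    = (\prod_(k <- J) P (Y k @^-1` A k))%E.

Definition identically_distributed (R : realType) (d d' : measure_display)
    (Omega : measurableType d) (E : measurableType d')
    (P : probability Omega R) (Y : nat -> Omega -> E) : Prop :=
  forall (k : nat) (A : set E), measurable A ->
    P (Y k @^-1` A) = P (Y 0%N @^-1` A).

(* Cycles are numbered from 0: [T k] and [xi k] stand for T_{k+1}, xi_{k+1}.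
   [X t w] is unconstrained for t < 0, and on the null event where the epochs
   stay bounded, for t beyond their limit. *)
Definition regenerative (R : realType) (d : measure_display)
    (Omega : measurableType d) (P : probability Omega R)
    (X : R -> Omega -> R) (T : nat -> Omega -> R)
    (xi : nat -> R -> Omega -> R) : Prop :=
  [/\ (forall k w, 0 < T k w),
      (forall k, measurable_fun setT (regen_cycle T xi k)),
      mutually_independent P (regen_cycle T xi),
      identically_distributed P (regen_cycle T xi)
    & (forall t, 0 <= t -> measurable_fun setT (X t)) /\
      (forall k w t, epoch T k w <= t < epoch T k.+1 w ->
         X t w = xi k (t - epoch T k w) w)].

Definition cycle_max_cdf (R : realType) (d : measure_display)
    (Omega : measurableType d) (P : probability Omega R)
    (X : R -> Omega -> R) (T : nat -> Omega -> R) (x : R) : \bar R :=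
  P [set w | (running_sup (X ^~ w) (T 0%N w) <= x%:E)%E].

(* [lne 0 = -oo], so this is [+oo] where the distribution function is 1. *)
Definition log_tail (R : realType) (d : measure_display)
    (Omega : measurableType d) (P : probability Omega R)
    (X : R -> Omega -> R) (T : nat -> Omega -> R) (x : R) : \bar R :=
  (- lne (1 - cycle_max_cdf P X T x))%E.

(* [inf] is 0 on the empty set and on sets that are not bounded below. *)
Definition gen_inv (R : realType) (H : R -> R) (y : R) : R :=
  inf [set x | y < H x].

Definition regularly_varying (R : realType) (U : R -> R) (kappa : R) : Prop :=
  (exists x0 : R, measurable_fun `]x0, +oo[ U /\
     forall x, x0 < x -> 0 < U x) /\
  (exists V : R -> R,
     (\forall x \near +oo, U x = x `^ kappa * V x) /\
     (forall x, 0 < x -> V (t * x) / V t @[t --> +oo] --> (1 : R))).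

Definition hhat (R : realType) (H : R -> R) (y : R) : R :=
  (derive1 H (gen_inv H y))^-1.

(* Regular variation of [hhat H] includes its eventual positivity, which rules
   out H' = 0 at [gen_inv H y] for large y, as [0^-1 = 0]. *)
Definition condU (R : realType) (H : R -> R) : Prop :=
  [/\ H x @[x --> +oo] --> +oo,
      (exists x0 : R,
         (forall x y, x0 < x -> x <= y -> H x <= H y) /\
         (forall x, x0 < x -> derivable H x 1)),
      (\forall y \near +oo, is_derive (y : R) (1 : R) (gen_inv H) (hhat H y))
    & exists kappa : R, regularly_varying (hhat H) kappa].

(* Main.v *)
(* Let [Y_k] be the maximum over the [k]-th cycle, [G] the generalized inverse of
   [R0] and [U = G']. Since [R1] is bounded, [P(Y_k > G(z))] is of order [e^-z], so
   the maximum of the first [n] cycles behaves as [G] of the maximum of [n]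
   exponential variables. The Borel-Cantelli lemmas, applied along [n = 2^k], show
   that, for every [e > 0] and almost surely, this maximum is
   - eventually at most [G(ln n + (1 + e) ln ln n)], and infinitely often above
     [G(ln n + (1 - e) ln ln n)];
   - eventually above [G(ln n - (1 + e) ln ln ln n)], and infinitely often at most
     [G(ln n - (1 - e) ln ln ln n)].
   The number of cycles completed before time [t] lies between two constant
   multiples of [t]. This only shifts [ln n] by a bounded amount with respect to
   [ln (t / alphaT)], which the iterated logarithms absorb; no exact law of large
   numbers is needed. Finally [U] is regularly varying, so by the uniform
   convergence theorem [G(y + s) - G(y) ~ s U(y)] when [s = o(y)], and
   [U(y) = 1 / r0(G(y))]. *)

Require Import Defs.
From HB Require Import structures.
From mathcomp Require Import all_boot all_order all_algebra.
From mathcomp Require Import all_classical all_reals all_analysis.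
From mathcomp Require Import measurable_realfun.
From mathcomp Require Import lra ring.
Set Implicit Arguments.
Unset Strict Implicit.
Unset Printing Implicit Defensive.
Import Order.TTheory GRing.Theory Num.Theory.
Import numFieldNormedType.Exports.
Local Open Scope classical_set_scope.
Local Open Scope ring_scope.

(** The two claims that hold infinitely often need the second Borel-Cantelli lemma, but the maxima
    over the first [2 ^ k] cycles are not independent. The upper claim is therefore derived from
    single cycles: the [j]-th one exceeds [G (ln j + ln (ln j))] infinitely often because the series
    of [1 / (j ln j)] diverges. The lower claim is derived from disjoint blocks of cycles ending at
    [2 ^ (k ^ 2)], so sparse that the earlier cycles hardly count. The length and the maximum of one
    cycle may depend on each other. This does no harm: the growth of the epochs and the behaviour of
    the maxima are separate almost sure facts, combined path by path, and the event [low a k]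
    carries all that a path needs to know about the maxima. [condU] controls [R0] near [+oo] only.
    On the left, [R0] is bounded above because [R0 + R1] is monotone and [R1] is bounded; this makes
    [gen_inv R0] a true right inverse at large arguments. *)

Lemma lebesgue_measure_shift (R : realType) (A : set R) (a : R) :
  measurable A -> lebesgue_measure (+%R a @^-1` A) = lebesgue_measure A.
Proof.
move=> mA.
have ms : measurable_fun [set: R] (+%R a : R -> measurableTypeR R).
  by apply: measurable_funD => //; exact: measurable_cst.
pose f : {mfun _ >-> _} := HB.pack (+%R a : R -> measurableTypeR R)
  (isMeasurableFun.Build _ _ _ _ _ ms).
rewrite [RHS](@lebesgue_measure_unique R (pushforward lebesgue_measure f)) //.
move=> X [[b c] _ <-].
transitivity (lebesgue_measure (`]b - a, c - a]%classic : set R)); last first.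
  congr lebesgue_measure.
  by apply/seteqP; split=> x /=; rewrite !in_itv/= ltrBlDl lerBrDl.
rewrite !lebesgue_measure_itv /= !lte_fin ltrD2r.
by case: ifP => // _; rewrite -!EFinB; congr EFin; ring.
Qed.

(** * Slowly and regularly varying functions *)

Section slowly_varying.
Variables (R : realType) (f : R -> R) (x0 : R).
Hypothesis mf : measurable_fun `]x0, +oo[ f.
Hypothesis f_slow : forall u, f (x + u) - f x @[x --> +oo] --> 0.

Let good (y : nat -> R) (e : R) (n : nat) : set R :=
  \bigcap_(k in [set k | (n <= k)%N])
    (`[0, 2]%classic `&` [set v | `|f (y k + v) - f (y k)| <= e]).

Let measurable_good y e n : (forall k, x0 < y k) -> measurable (good y e n).
Proof.
move=> hy; apply: bigcap_measurable; first by exists n => /=.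
move=> k _.
have mfy : measurable_fun `[(0:R), 2] (fun v => f (y k + v)).
  apply: (@measurable_comp _ _ _ _ _ _ `]x0, +oo[%classic) => //.
    move=> _ [v /= + <-]; rewrite !in_itv/= andbT => /andP[v0 _].
    by rewrite ltr_wpDr.
  by apply: measurable_funD => //; exact: measurable_cst.
have mg : measurable_fun `[(0:R), 2] (fun v => `|f (y k + v) - f (y k)|).
  apply: measurableT_comp => //.
  by apply: measurable_funB => //; exact: measurable_cst.
rewrite (_ : [set v | _] = (fun v => `|f (y k + v) - f (y k)|) @^-1` `]-oo, e]).
  by apply: mg.
by apply/seteqP; split => v /=; rewrite in_itv.
Qed.

(** Egorov's argument: by pointwise convergence the sets [good y e n] increase to [[0, 2]], so their
    measures tend to 2. Any threshold from 3/2 up to 2 (excluded) would serve, since two such sets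
    cannot be disjoint inside [[0, 3]]. *)
Let good_full y e : 0 < e -> (forall k, x0 < y k) -> y @ \oo --> +oo ->
  \forall n \near \oo, (lebesgue_measure (good y e n) > (7 / 4 : R)%:E)%E.
Proof.
move=> e0 hy yoo.
have gU : \bigcup_n good y e n = `[0, 2]%classic.
  apply/seteqP; split => [v [i _ /(_ i (leqnn i)) []] //|v v02].
  have /yoo[n _ nP] : \forall x \near +oo, `|0 - (f (x + v) - f x)| <= e.
    exact: (@cvgr_dist_le _ _ _ _ _ _ _ (f_slow v)).
  by exists n => // k /= nk; split => //; have := nP k nk; rewrite /= sub0r normrN.
have : lebesgue_measure (good y e n) @[n --> \oo] -->
    lebesgue_measure (\bigcup_n good y e n).
  apply: nondecreasing_cvg_mu.
  - by move=> i; exact: measurable_good.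
  - by rewrite gU.
  - by move=> i j ij; apply/subsetPset => v gv k /= nk; apply: gv; exact: leq_trans nk.
rewrite gU lebesgue_measure_itv /= lte_fin ltr0n /= sube0.
move=> /(_ [set z | ((7 / 4 : R)%:E < z)%E]); apply.
by apply: open_nbhs_nbhs; split; [exact: open_ereal_gt_ereal|rewrite /= lte_fin; lra].
Qed.

(* If uniformity fails along points [x_n] and increments [u_n], then the sets of
   good increments from [x_n], and from [x_n + u_n] after translation by [u_n],
   both nearly fill an interval of length 2 inside [0, 3], so they meet. *)
Lemma slowly_varying_uniform (e : R) : 0 < e ->
  \forall x \near +oo, forall u, 0 <= u <= 1 -> `|f (x + u) - f x| <= e.
Proof.
move=> e0; apply: contrapT => H.
have {H} /choice[x xP] : forall n, exists xu : R * R,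
    [/\ x0 + n%:R < xu.1, n%:R < xu.1, 0 <= xu.2 <= 1
      & e < `|f (xu.1 + xu.2) - f xu.1|].
  move=> n; apply: contrapT => K; apply: H.
  exists (Num.max (x0 + n%:R) n%:R); split; first exact: num_real.
  move=> x; rewrite gt_max => /andP[x1 x2] u u01; rewrite leNgt; apply/negP => xu.
  by apply: K; exists (x, u).
pose y n := (x n).1; pose z n := (x n).1 + (x n).2.
have hy k : x0 < y k.
  by have [+ _ _ _] := xP k; apply: le_lt_trans; rewrite lerDl.
have hz k : x0 < z k.
  by have [_ _ /andP[u0 _] _] := xP k; rewrite ltr_wpDr //; exact: hy.
have yoo : y @ \oo --> +oo.
  apply/cvgryPge => A; near=> n.
  have [_ + _ _] := xP n; move/ltW; apply: le_trans.
  by near: n; exact: nbhs_infty_ger.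
have zoo : z @ \oo --> +oo.
  apply/cvgryPge => A; near=> n.
  have [_ _ /andP[+ _] _] := xP n; rewrite -(lerDl (y n)); apply: le_trans.
  by near: n; move/cvgryPge : yoo; exact.
have e2 : 0 < e / 2 by rewrite divr_gt0.
near \oo => n.
have mA : measurable (good y (e / 2) n) by exact: measurable_good.
have mB : measurable (good z (e / 2) n) by exact: measurable_good.
have A_gt : (lebesgue_measure (good y (e / 2) n) > (7 / 4 : R)%:E)%E.
  by near: n; exact: good_full.
have B_gt : (lebesgue_measure (good z (e / 2) n) > (7 / 4 : R)%:E)%E.
  by near: n; exact: good_full.
have [_ _ u01 ex] := xP n.
set u := (x n).2 in u01.
pose B' := +%R (- u) @^-1` (good z (e / 2) n).
have ms : measurable_fun [set: R] (+%R (- u) : R -> R).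
  by apply: measurable_funD => //; exact: measurable_cst.
have mB' : measurable B' by rewrite -[B']setTI; exact: ms.
(* Since [y n + v = z n + (v - u)], a common [v] would put both [f (y n)] and [f (z n)] within
   [e / 2] of [f (y n + v)], against the choice of [x n]. *)
have AB0 : good y (e / 2) n `&` B' = set0.
  rewrite -subset0 => v [/(_ n (leqnn n))[_ /= h1] /(_ n (leqnn n))[_ /= h2]].
  move: ex; apply/negP; rewrite -leNgt -/u -/(y n).
  rewrite /z -/u -/(y n) [_ + (- u + v)](_ : _ = y n + v) in h2; last by ring.
  by move: h1 h2; rewrite !ler_norml => /andP[? ?] /andP[? ?]; apply/andP; split; lra.
have : (lebesgue_measure (good y (e / 2) n `|` B') <=
    lebesgue_measure (`[0%R, 3%R]%classic : set R))%E.
  apply: le_measure; rewrite ?inE//=; first exact: measurableU.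
  move=> v [/(_ n (leqnn n))[/= + _]|/(_ n (leqnn n))[/= + _]];
    rewrite !in_itv/= => /andP[? ?]; apply/andP; split; move/andP : u01 => [? ?]; lra.
have B'E : lebesgue_measure B' = lebesgue_measure (good z (e / 2) n).
  exact: lebesgue_measure_shift.
have -> : (lebesgue_measure (good y (e / 2) n `|` B') =
    lebesgue_measure (good y (e / 2) n) + lebesgue_measure B')%E.
  exact: measureU.
rewrite B'E lebesgue_measure_itv /= lte_fin ltr0n /= sube0.
apply/negP; rewrite -ltNge.
apply: lt_le_trans (leeD (ltW A_gt) (ltW B_gt)).
by rewrite -EFinD lte_fin; lra.
Unshelve. all: by end_near. Qed.

End slowly_varying.

Lemma ln_sub_le (R : realType) (a b : R) : 0 < a -> 0 < b ->
  ln a - ln b <= (a - b) / b.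
Proof.
move=> a0 b0; rewrite -ln_div ?posrE// -[a / b](subrK 1) addrC.
rewrite [X in _ <= X](_ : _ = a / b - 1); last by field; rewrite gt_eqF.
by apply: le_ln1Dx; rewrite ltrBrDl subrr divr_gt0.
Qed.

Lemma cvgy_ln (R : realType) : ln y @[y --> +oo] --> (+oo : set_system R).
Proof.
apply/cvgryPge => A; near=> y.
have Ay : expR A <= y by near: y; apply: nbhs_pinfty_ge; exact: num_real.
by rewrite -[A]expRK ler_ln ?posrE ?expR_gt0// (lt_le_trans (expR_gt0 A)).
Unshelve. all: by end_near. Qed.

Lemma cvgy_expR (R : realType) : expR y @[y --> +oo] --> (+oo : set_system R).
Proof.
apply/cvgryPge => A; near=> y.
apply: le_trans (expR_ge1Dx y); rewrite -lerBlDl.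
by near: y; apply: nbhs_pinfty_ge; exact: num_real.
Unshelve. all: by end_near. Qed.

Section slow.
Variable R : realType.

(* The functions [m] for which a correction of order [m y] absorbs a bounded
   shift of [y] but is negligible with respect to [y]. *)
Definition slow (m : R -> R) : Prop :=
  [/\ m y @[y --> +oo] --> +oo,
      forall e, 0 < e -> \forall y \near +oo, m y <= e * y
    & forall K, \forall y \near +oo, forall z, `|z - y| <= K -> `|m z - m y| <= 1].

Lemma slow_ln : slow (@ln R).
Proof.
split; first exact: cvgy_ln.
- move=> e e0; near=> y.
  have y0 : 0 < y by near: y; apply: nbhs_pinfty_gt; exact: num_real.
  have : ln (e / 2 * y) < e / 2 * y by apply: ln_sublinear; rewrite mulr_gt0 ?divr_gt0.
  rewrite lnM ?posrE ?divr_gt0// => h.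
  have : - ln (e / 2) / (e / 2) <= y.
    by near: y; apply: nbhs_pinfty_ge; exact: num_real.
  rewrite ler_pdivrMr ?divr_gt0// => h2; lra.
- move=> K; near=> y => z zy.
  have y1 : 1 + `|K| *+ 2 <= y.
    by near: y; apply: nbhs_pinfty_ge; exact: num_real.
  have K0 := ler_norm K; have K0' := normr_ge0 K.
  move: zy; rewrite mulr2n in y1; rewrite !ler_norml => /andP[zy1 zy2].
  have y0 : 0 < y by lra.
  have z0 : 0 < z by lra.
  apply/andP; split.
    rewrite lerNl opprB; apply: le_trans (ln_sub_le _ _) _ => //.
    by rewrite ler_pdivrMr//; lra.
  apply: le_trans (ln_sub_le _ _) _ => //.
  by rewrite ler_pdivrMr//; lra.
Unshelve. all: by end_near. Qed.

Lemma slow_ln_comp (m : R -> R) : slow m -> slow (fun y => ln (m y)).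
Proof.
move=> [moo mle mK]; split.
- by apply: cvg_comp moo _; exact: cvgy_ln.
- move=> e e0; near=> y.
  have m0 : 1 <= m y by near: y; move/cvgryPge : moo; exact.
  apply: le_trans (ltW (ln_sublinear _)) _; first by rewrite (lt_le_trans _ m0).
  by near: y; exact: mle.
- move=> K; near=> y => z zy.
  have m0 : 2 <= m y by near: y; move/cvgryPge : moo; exact.
  have : `|m z - m y| <= 1.
    by move: z zy; near: y; exact: mK.
  rewrite !ler_norml => /andP[mzy1 mzy2].
  have my0 : 0 < m y by lra.
  have mz0 : 0 < m z by lra.
  apply/andP; split.
    rewrite lerNl opprB; apply: le_trans (ln_sub_le _ _) _ => //.
    by rewrite ler_pdivrMr//; lra.
  apply: le_trans (ln_sub_le _ _) _ => //.
  by rewrite ler_pdivrMr//; lra.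
Unshelve. all: by end_near. Qed.

(** The gap [(b - a) * m y] tends to infinity and outweighs the bounded shifts. The points [z] and
    [w] are separate because the correction is evaluated at [ln t] while the centring uses
    [ln (t / alphaT)]. *)
Lemma slow_shift (m : R -> R) (a b K : R) : slow m -> a < b ->
  \forall y \near +oo, forall z w, `|z - y| <= K -> `|w - y| <= K ->
    y + a * m y <= w + b * m z /\ w + a * m z <= y + b * m y.
Proof.
move=> [moo mle mK] ab; near=> y => z w zy wy.
have : `|m z - m y| <= 1 by move: z zy; near: y; exact: mK.
have my : (K + `|a| + `|b|) / (b - a) <= m y.
  by near: y; move/cvgryPge : moo; exact.
move: my; rewrite ler_pdivrMr ?subr_gt0// => my mD.
have ha : `|a * (m z - m y)| <= `|a| by rewrite normrM ler_piMr.
have hb : `|b * (m z - m y)| <= `|b| by rewrite normrM ler_piMr.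
have a0 := normr_ge0 a; have b0 := normr_ge0 b.
move: wy ha hb; rewrite !ler_norml => /andP[? ?] /andP[? ?] /andP[? ?].
by split; lra.
Unshelve. all: by end_near. Qed.

End slow.

Section regular_variation.
Variable R : realType.

Lemma expR_sub1_le (w e d : R) : `|w| <= e -> e <= 2^-1 -> e <= d / 2 ->
  `|expR w - 1| <= d.
Proof.
rewrite ler_norml => /andP[w1 w2] ew2 ewd.
have h1 := expR_ge1Dx w; have h2 := expR_ge1Dx (- w); have h4 := expR_gt0 w.
have h3 : expR (- w) * expR w = 1 by rewrite -expRD addNr expR0.
have h5 : (1 - w) * expR w <= expR (- w) * expR w by rewrite ler_pM2r.
have h6 : (2^-1 - (1 - w)) * expR w <= 0 by rewrite pmulr_lle0 //; lra.
have h7 : (w - e) * expR w <= 0 by rewrite pmulr_lle0 //; lra.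
have h8 : expR w <= 2 by lra.
have h9 : e * expR w <= e * 2 by rewrite ler_wpM2l//; lra.
by rewrite ler_norml; apply/andP; split; lra.
Qed.

Lemma ln_dist_le (y v eta : R) : 0 < y -> eta <= 2^-1 -> `|v - y| <= eta * y ->
  y / 2 <= v /\ `|ln v - ln y| <= 2 * eta.
Proof.
move=> y0 eta2 vy.
have eta0 : 0 <= eta by rewrite -(pmulr_lge0 _ y0); exact: le_trans vy.
have ety : eta * y <= 2^-1 * y by rewrite ler_wpM2r// ltW.
move: vy; rewrite ler_norml => /andP[vy1 vy2].
have v2 : y / 2 <= v by lra.
have v0 : 0 < v by lra.
split=> //; rewrite ler_norml; apply/andP; split.
  rewrite lerNl opprB; apply: le_trans (ln_sub_le _ _) _ => //.
  rewrite ler_pdivrMr//; apply: (@le_trans _ _ (eta * y)); first by lra.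
  by rewrite -mulrA (mulrCA 2) ler_wpM2l//; lra.
apply: le_trans (ln_sub_le _ _) _ => //.
by rewrite ler_pdivrMr//; have : 0 <= eta * y by [exact: mulr_ge0 (ltW y0)]; lra.
Qed.

(** In logarithmic coordinates, [f x = ln (U (expR x)) - kappa * x] is additively slowly varying,
    hence uniformly so. For [v] at relative distance [eta] from [y], what remains of
    [ln (U v) - ln (U y)] is [kappa * (ln v - ln y)], which [eta] makes small. *)
Lemma regularly_varying_local (U : R -> R) (kappa d : R) :
  regularly_varying U kappa -> 0 < d ->
  exists2 eta, 0 < eta & \forall y \near +oo, forall v, `|v - y| <= eta * y ->
    0 < U v /\ `|U v - U y| <= d * U y.
Proof.
move=> [[x0 [mU U0]] [V [UV Vs]]] d0.
pose f x := ln (U (expR x)) - kappa * x.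
have f_slow u : f (x + u) - f x @[x --> +oo] --> 0.
  have /(_ _ (expR_gt0 u)) := Vs.
  have expoo : expR y @[y --> +oo] --> (+oo : set_system R) by exact: cvgy_expR.
  move=> /(cvg_comp _ _ expoo) h.
  have : ln (V (expR x * expR u) / V (expR x)) @[x --> +oo] --> ln (1 : R).
    apply: cvg_comp h _; exact: continuous_ln.
  rewrite ln1; apply: cvg_trans; apply: near_eq_cvg; near=> x.
  have U1 : U (expR x) = expR x `^ kappa * V (expR x).
    by near: x; exact: (expoo _ UV).
  have U2 : U (expR (x + u)) = expR (x + u) `^ kappa * V (expR (x + u)).
    by near: x; exact: (cvg_comp _ _ (cvg_addrr u) expoo _ UV).
  have p1 : 0 < U (expR x).
    by apply: U0; near: x; move/cvgryPgt : expoo; exact.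
  have p2 : 0 < U (expR (x + u)).
    apply: U0; near: x.
    by move/cvgryPgt : (cvg_comp _ _ (cvg_addrr u) expoo); exact.
  have q1 : 0 < V (expR x) by move: p1; rewrite U1 pmulr_rgt0// powR_gt0// expR_gt0.
  have q2 : 0 < V (expR (x + u)).
    by move: p2; rewrite U2 pmulr_rgt0// powR_gt0// expR_gt0.
  rewrite -expRD ln_div ?posrE// /f U1 U2 !lnM ?posrE ?powR_gt0 ?expR_gt0//.
  by rewrite !ln_powR !expRK; ring.
have mf : measurable_fun `]ln (Num.max x0 1), +oo[ f.
  apply: measurable_funB; last by apply: measurable_funM => //; exact: measurable_cst.
  apply: measurableT_comp => //.
  apply: (@measurable_comp _ _ _ _ _ _ `]x0, +oo[%classic) => //.
    move=> _ [v /= + <-]; rewrite !in_itv/= !andbT => v0.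
    have m0 : 0 < Num.max x0 1 by rewrite lt_max ltr01 orbT.
    apply: (@le_lt_trans _ _ (Num.max x0 1)); first by rewrite le_max lexx.
    by rewrite -[ltLHS](lnK m0) ltr_expR.
  exact: measurable_funTS.
pose e := Num.min 2^-1 (d / 2).
have e0 : 0 < e by rewrite lt_min invr_gt0 ltr0Sn divr_gt0.
have e20 : 0 < e / 2 by rewrite divr_gt0.
have [X [_ XP]] := slowly_varying_uniform mf f_slow e20.
pose k := `|kappa| + 1.
have k0 : 0 < k by rewrite ltr_wpDl.
pose eta := Num.min 2^-1 (e / (4 * k)).
have eta0 : 0 < eta by rewrite lt_min invr_gt0 ltr0n divr_gt0// mulr_gt0.
exists eta => //; near=> y => v vy.
have y0 : 0 < y by near: y; apply: nbhs_pinfty_gt; exact: num_real.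
have yx0 : 2 * `|x0| < y by near: y; apply: nbhs_pinfty_gt; exact: num_real.
have yX : 2 * expR X < y by near: y; apply: nbhs_pinfty_gt; exact: num_real.
have eta2 : eta <= 2^-1 by rewrite ge_min lexx.
have etak : eta * 4 * k <= e.
  by rewrite -mulrA -ler_pdivlMr ?mulr_gt0// ge_min lexx orbT.
have x00 := normr_ge0 x0; have x0n := ler_norm x0; have X0 := expR_gt0 X.
have [v2 lnvy] := ln_dist_le y0 eta2 vy.
have v0 : 0 < v by lra.
have Uy0 : 0 < U y by apply: U0; lra.
have Uv0 : 0 < U v by apply: U0; lra.
split => //.
have lnX a : expR X < a -> X < ln a.
  by move=> Xa; rewrite -[X]expRK ltr_ln ?posrE// (lt_trans X0).
have fvy : `|f (ln v) - f (ln y)| <= e / 2.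
  (* Uniformity is available for increments in [[0, 1]] only, so the smaller of the two points
     serves as base. *)
  have [ab|ba] := leP (ln y) (ln v).
    have := XP (ln y) _ (ln v - ln y); rewrite (addrC (ln y)) subrK; apply.
      by apply: lnX; lra.
    by move: lnvy; rewrite ger0_norm ?subr_ge0//; lra.
  rewrite distrC.
  have := XP (ln v) _ (ln y - ln v); rewrite (addrC (ln v)) subrK; apply.
    by apply: lnX; lra.
  by move: lnvy; rewrite distrC ger0_norm ?subr_ge0 ?(ltW ba)//; move: ba; lra.
pose w := ln (U v) - ln (U y).
have wE : w = f (ln v) - f (ln y) + kappa * (ln v - ln y).
  by rewrite /w /f !lnK ?posrE//; ring.
have we : `|w| <= e.
  rewrite wE (le_trans (ler_normD _ _))//.
  have : `|kappa * (ln v - ln y)| <= k * (2 * eta).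
    by rewrite normrM ler_pM// lerDl.
  by move: fvy etak; lra.
have Uw : U v = expR w * U y.
  by rewrite /w expRD expRN !lnK ?posrE// mulfVK// gt_eqF.
have ew2 : e <= 2^-1 by rewrite ge_min lexx.
have ewd : e <= d / 2 by rewrite ge_min lexx orbT.
rewrite Uw -{2}[U y]mul1r -mulrBl normrM (gtr0_norm Uy0) ler_pM2r//.
exact: expR_sub1_le we ew2 ewd.
Unshelve. all: by end_near. Qed.

End regular_variation.

(** * Increments of a function with regularly varying derivative *)

Section increments.
Variables (R : realType) (G U : R -> R) (kappa : R).
Hypothesis rvU : regularly_varying U kappa.
Hypothesis dG : \forall y \near +oo, is_derive (y : R) (1 : R) G (U y).

Lemma mean_value (a b : R) : a <= b ->
  (forall x, a <= x <= b -> is_derive x (1 : R) G (U x)) ->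
  exists2 c, a <= c <= b & G b - G a = U c * (b - a).
Proof.
move=> ab dab; have [||c] := @MVT_segment R G U a b ab.
- by move=> x; rewrite in_itv/= => /andP[? ?]; apply: dab; rewrite !ltW.
- apply: derivable_within_continuous => x; rewrite in_itv/= => /dab h.
  by have [] := h.
- by rewrite in_itv/= => ? ?; exists c.
Qed.

(** Mean value theorem: the increment is [U c * s] with [c] between [y] and [y + s], a range on
    which [U] is nearly constant. *)
Lemma increment_local (d : R) : 0 < d ->
  exists2 eta, 0 < eta & \forall y \near +oo, 0 < U y /\
    forall s, `|s| <= eta * y -> `|G (y + s) - G y - s * U y| <= d * `|s| * U y.
Proof.
move=> d0; have [eta eta0 H] := regularly_varying_local rvU d0.
(* The bound [2^-1] keeps [y + s] above [y / 2], where [G] is known to be differentiable. *)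
exists (Num.min eta 2^-1); first by rewrite lt_min eta0 invr_gt0 ltr0n.
have [X [_ dX]] := dG.
near=> y.
have y0 : 0 < y by near: y; apply: nbhs_pinfty_gt; exact: num_real.
have yX : 2 * `|X| < y by near: y; apply: nbhs_pinfty_gt; exact: num_real.
have X0 := ler_norm X; have X0' := normr_ge0 X.
have Hy : forall v, `|v - y| <= eta * y -> 0 < U v /\ `|U v - U y| <= d * U y.
  by near: y.
split.
  by have [|] := Hy y; rewrite // subrr normr0 mulr_ge0 ?ltW.
move=> s.
set e := Num.min _ _ => sy.
have sy1 : `|s| <= eta * y.
  by apply: le_trans sy _; rewrite ler_pM2r// ge_min lexx.
have sy2 : `|s| <= y / 2.
  by apply: le_trans sy _; rewrite (mulrC y) ler_pM2r// ge_min lexx orbT.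
suff [c cy ->] : exists2 c, `|c - y| <= `|s| & G (y + s) - G y = U c * s.
  rewrite (mulrC s) -mulrBl normrM mulrAC ler_wpM2r//.
  by have [] := Hy c => //; exact: le_trans sy1.
have [s0|s0] := leP 0 s.
  rewrite ger0_norm // in sy2 *.
  have [||c /andP[c1 c2]] := @mean_value y (y + s).
  - by rewrite lerDl.
  - by move=> x /andP[x1 x2]; apply: dX; lra.
  rewrite [y + s - y]addrC addKr => ->; exists c => //.
  by rewrite ger0_norm; lra.
rewrite ltr0_norm // in sy2 *.
have [||c /andP[c1 c2]] := @mean_value (y + s) y.
- lra.
- by move=> x /andP[x1 x2]; apply: dX; lra.
move=> h; exists c; first by rewrite ler0_norm; lra.
by rewrite -opprB h; ring.
Unshelve. all: by end_near. Qed.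

Lemma eventually_increasing :
  exists y0, forall a b, y0 < a -> a <= b -> G a <= G b.
Proof.
have [X [_ dX]] := dG; have [[x0 [_ U0]] _] := rvU.
exists (Num.max X x0) => a b; rewrite gt_max => /andP[Xa xa] ab.
have [//|x /andP[ax xb]|c /andP[ac cb] h] := @mean_value a b.
  by apply: dX; exact: lt_le_trans ax.
rewrite -subr_ge0 h mulr_ge0 ?subr_ge0// ltW//.
by apply: U0; exact: lt_le_trans ac.
Qed.

Lemma scaled_increment (m : R -> R) (c alpha e : R) : slow m -> 0 < alpha -> 0 < e ->
  \forall t \near +oo,
   [/\ 0 < U (ln (t / alpha)), 0 < m (ln t)
     & `|(U (ln (t / alpha)))^-1 * (G (ln (t / alpha) + c * m (ln t)) - G (ln (t / alpha)))
         / m (ln t) - c| <= e].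
Proof.
move=> [moo mle mK] alpha0 e0.
have k0 : 0 < `|c| + 1 by rewrite ltr_wpDl.
have [eta eta0 H] := increment_local (divr_gt0 e0 k0).
have ln_oo : ln t @[t --> +oo] --> (+oo : set_system R) by exact: cvgy_ln.
have lna_oo : ln (t / alpha) @[t --> +oo] --> (+oo : set_system R).
  apply/cvgryPge => A; near=> t.
  have t0 : 0 < t by near: t; apply: nbhs_pinfty_gt; exact: num_real.
  rewrite ln_div ?posrE// lerBrDr; near: t.
  by move/cvgryPge : ln_oo; exact.
(* The factor 2 pays for [ln t <= 2 * ln (t / alpha)], true for large [t]; the added 1 allows
   [c = 0]. *)
have h : 0 < eta / (2 * (`|c| + 1)) by rewrite divr_gt0// mulr_gt0.
near=> t.
have t0 : 0 < t by near: t; apply: nbhs_pinfty_gt; exact: num_real.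
have m0 : 0 < m (ln t).
  by near: t; move/cvgryPgt : (cvg_comp _ _ ln_oo moo); exact.
have m_le : m (ln t) <= eta / (2 * (`|c| + 1)) * ln t.
  by near: t; exact: (ln_oo _ (mle _ h)).
have lnt : `|ln alpha| *+ 2 <= ln t by near: t; move/cvgryPge : ln_oo; exact.
have [] : 0 < U (ln (t / alpha)) /\
    forall s, `|s| <= eta * ln (t / alpha) ->
    `|G (ln (t / alpha) + s) - G (ln (t / alpha)) - s * U (ln (t / alpha))|
      <= e / (`|c| + 1) * `|s| * U (ln (t / alpha)).
  by near: t; exact: (lna_oo _ H).
rewrite ln_div ?posrE//.
set y := ln t - ln alpha; set s := c * m (ln t) => Uy0 /(_ s) Hs.
split => //.
have lna := ler_norm (ln alpha); rewrite mulr2n in lnt.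
have lny : ln t / 2 <= y by rewrite /y; lra.
have {Hs} Hs : `|G (y + s) - G y - s * U y| <= e / (`|c| + 1) * `|s| * U y.
  apply: Hs; rewrite normrM (gtr0_norm m0).
  apply: (@le_trans _ _ ((`|c| + 1) * (eta / (2 * (`|c| + 1)) * ln t))).
    by apply: ler_pM => //; [exact: ltW|rewrite lerDl].
  have -> : (`|c| + 1) * (eta / (2 * (`|c| + 1)) * ln t) = eta * (ln t / 2).
    by field; rewrite gt_eqF.
  by rewrite ler_pM2l.
rewrite (_ : _ - c = (G (y + s) - G y - s * U y) / (U y * m (ln t))); last first.
  by rewrite /s; field; rewrite !gt_eqF.
have Um0 : 0 < U y * m (ln t) by rewrite mulr_gt0.
rewrite normrM (gtr0_norm (x := _^-1)) ?invr_gt0// ler_pdivrMr//.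
apply: le_trans Hs _; rewrite normrM (gtr0_norm m0).
rewrite (_ : _ * U y = e * (`|c| / (`|c| + 1)) * (U y * m (ln t))); last first.
  by field; rewrite gt_eqF.
rewrite ler_pM2r// ler_piMr//; first exact: ltW.
by rewrite ler_pdivrMr// mul1r lerDl.
Unshelve. all: by end_near. Qed.

End increments.

(** * Limits superior and inferior at infinity *)

Lemma limf_esup_pinfty_eq (R : realType) (f : R -> \bar R) (l : R) :
  (forall e, 0 < e -> \forall t \near +oo, (f t <= (l + e)%:E)%E) ->
  (forall e, 0 < e -> forall t0, exists2 t, t0 < t & ((l - e)%:E <= f t)%E) ->
  limf_esup f (pinfty_nbhs R) = l%:E.
Proof.
move=> fle fge; rewrite limf_esupE; apply/eqP; rewrite eq_le; apply/andP; split.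
  apply/lee_addgt0Pr => e e0.
  apply: (@le_trans _ _ (ereal_sup (f @` [set t | (f t <= (l + e)%:E)%E]))).
    apply: ereal_inf_lbound.
    by exists [set t | (f t <= (l + e)%:E)%E] => //; exact: fle.
  by apply: ge_ereal_sup => _ [t /= ft <-]; rewrite -EFinD.
apply: le_ereal_inf_tmp => _ [V [t0 [_ Vt0]] <-].
apply/lee_subgt0Pr => e e0.
have [t t0t ft] := fge e e0 t0.
by rewrite -EFinB (le_trans ft)// ereal_sup_ubound//; exists t => //; exact: Vt0.
Qed.

Lemma limf_einf_pinfty_eq (R : realType) (f : R -> \bar R) (l : R) :
  (forall e, 0 < e -> \forall t \near +oo, ((l - e)%:E <= f t)%E) ->
  (forall e, 0 < e -> forall t0, exists2 t, t0 < t & (f t <= (l + e)%:E)%E) ->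
  limf_einf f (pinfty_nbhs R) = l%:E.
Proof.
move=> fge fle; rewrite /limf_einf (@limf_esup_pinfty_eq _ _ (- l)) ?EFinN ?oppeK//.
- move=> e e0; apply: filterS (fge e e0) => t; rewrite leeNl -EFinN opprD opprK; exact.
- move=> e e0 t0; have [t t0t ft] := fle e e0 t0; exists t => //.
  by rewrite leeNr -EFinN opprB opprK addrC.
Qed.

(** * From the cycle maxima to the running maximum *)

Section deterministic.
Variables (R : realType) (G U : R -> R) (kappa : R).
Hypothesis rvU : regularly_varying U kappa.
Hypothesis dG : \forall y \near +oo, is_derive (y : R) (1 : R) G (U y).
Variables (alpha : R) (m : R -> R).
Hypotheses (alpha0 : 0 < alpha) (sm : slow m).

(** The normalisation is nondecreasing in [x], so it is enough to compare [x] with a level. [x] is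
    an extended real since a path may have an infinite supremum. *)
Lemma scaled_increment_ereal (c e : R) : 0 < e -> \forall t \near +oo, forall x : \bar R,
  let y := ln (t / alpha) in
  ((x <= (G (y + c * m (ln t)))%:E ->
      ((U y)^-1)%:E * (x - (G y)%:E) / (m (ln t))%:E <= (c + e)%:E) /\
   ((G (y + c * m (ln t)))%:E <= x ->
      (c - e)%:E <= ((U y)^-1)%:E * (x - (G y)%:E) / (m (ln t))%:E))%E.
Proof.
move=> e0; apply: filterS (scaled_increment rvU dG c sm alpha0 e0) => t [U0 m0].
set y := ln (t / alpha); set z := G (y + _) => H x /=.
rewrite inver gt_eqF//.
have V0 : 0 <= (U y)^-1 by rewrite invr_ge0 ltW.
have W0 : 0 <= (m (ln t))^-1 by rewrite invr_ge0 ltW.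
have zE : ((U y)^-1%:E * (z%:E - (G y)%:E) * (m (ln t))^-1%:E)%E =
  ((U y)^-1 * (z - G y) / m (ln t))%:E by [].
move: H; rewrite ler_norml => /andP[H1 H2].
split => xz.
  apply: (@le_trans _ _ ((U y)^-1%:E * (z%:E - (G y)%:E) * (m (ln t))^-1%:E)%E).
    by apply: lee_wpmul2r => //; apply: lee_wpmul2l => //; exact: leeD2r.
  by rewrite zE lee_fin -lerBlDl.
apply: (@le_trans _ _ ((U y)^-1%:E * (z%:E - (G y)%:E) * (m (ln t))^-1%:E)%E).
  by rewrite zE lee_fin; lra.
by apply: lee_wpmul2r => //; apply: lee_wpmul2l => //; exact: leeD2r.
Qed.

Lemma drift_cvgy (a : R) : y + a * m y @[y --> +oo] --> (+oo : set_system R).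
Proof.
have [moo mle _] := sm.
have k0 : 0 < `|a| + 1 by rewrite ltr_wpDl.
have h : 0 < (2 * (`|a| + 1))^-1 by rewrite invr_gt0 mulr_gt0.
apply/cvgryPge => A; near=> y.
have m0 : 0 < m y by near: y; move/cvgryPgt : moo; exact.
have y0 : 0 < y by near: y; apply: nbhs_pinfty_gt; exact: num_real.
have yA : `|A| *+ 2 <= y by near: y; apply: nbhs_pinfty_ge; exact: num_real.
have m_le : m y <= (2 * (`|a| + 1))^-1 * y by near: y; exact: mle.
have : `|a * m y| <= y / 2.
  rewrite normrM (gtr0_norm m0).
  apply: (@le_trans _ _ ((`|a| + 1) * ((2 * (`|a| + 1))^-1 * y))).
    by apply: ler_pM => //; [exact: ltW|rewrite lerDl].
  by rewrite invfM mulrA mulrCA divff ?gt_eqF// mulr1 mulrC.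
rewrite mulr2n in yA; have := ler_norm A.
by rewrite ler_norml => ? /andP[? ?]; lra.
Unshelve. all: by end_near. Qed.

(* [Y] stands for the cycle maxima, [S] for the regeneration epochs and [Xb] for the
   running maximum. *)
Variables (Xb : R -> \bar R) (Y : nat -> \bar R) (S : nat -> R) (c C : R).
Hypothesis Xb_le : forall n t x, t <= S n -> (forall j, (j < n)%N -> (Y j <= x)%E) -> (Xb t <= x)%E.
Hypothesis Xb_ge : forall n t j, S n <= t -> (j < n)%N -> (Y j <= Xb t)%E.
Hypotheses (c0 : 0 < c) (C0 : 0 < C).
Hypothesis S_ge : \forall k \near \oo, c * 2 ^+ k <= S (2 ^ k).
Hypothesis S_le : \forall k \near \oo, S (2 ^ k) <= C * 2 ^+ k.

Definition level (a : R) (k : nat) : R := G (ln (2 ^+ k) + a * m (ln (2 ^+ k))).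

Lemma cvgy_ln_exp2 : ln (2 ^+ k : R) @[k --> \oo] --> (+oo : set_system R).
Proof.
apply/cvgryPge => A; near=> k.
rewrite lnXn// -[ln 2 *+ k]mulr_natl -ler_pdivrMr ?ln_gt0 ?ltr1n//.
by near: k; exact: nbhs_infty_ger.
Unshelve. all: by end_near. Qed.

(* A bounded multiplicative error between [t] and [2 ^+ k] shifts the argument of
   [G] by [O(1)], hence is absorbed by any change of the coefficient of [m]. *)
Lemma level_shift (a b K : R) : 1 <= K -> a < b -> \forall k \near \oo, forall t,
  2 ^+ k / K <= t -> t <= K * 2 ^+ k ->
    level a k <= G (ln (t / alpha) + b * m (ln t)) /\
    G (ln (t / alpha) + a * m (ln t)) <= level b k.
Proof.
move=> K1 ab; have [y0 Gle] := eventually_increasing rvU dG.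
have K0 : 0 < K by lra.
have lnK0 : 0 <= ln K by rewrite ln_ge0.
(* [G] is monotone only beyond [y0]; the comparison with coefficient [a - 1] shows that
   [ln (t / alpha) + a * m (ln t)] lies there. *)
have a1 : a - 1 < a by lra.
pose L := ln K + `|ln alpha|.
pose close a b y := forall z w, `|z - y| <= L -> `|w - y| <= L ->
    y + a * m y <= w + b * m z /\ w + a * m z <= y + b * m y.
have H1 : \forall k \near \oo, close a b (ln (2 ^+ k)).
  exact: cvgy_ln_exp2 _ (slow_shift L sm ab).
have H2 : \forall k \near \oo, close (a - 1) a (ln (2 ^+ k)).
  exact: cvgy_ln_exp2 _ (slow_shift L sm a1).
near=> k => t t1 t2.
have k0 : (0:R) < 2 ^+ k by rewrite exprn_gt0.
have t0 : 0 < t by apply: lt_le_trans t1; rewrite divr_gt0.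
have ty : `|ln t - ln (2 ^+ k)| <= ln K + `|ln alpha|.
  apply: (@le_trans _ _ (ln K)); last by rewrite lerDl.
  rewrite ler_norml; apply/andP; split.
    rewrite lerBrDl -ln_div ?posrE// ler_ln ?posrE// divr_gt0//.
  by rewrite lerBlDr -lnM ?posrE// ler_ln ?posrE// mulr_gt0.
have wy : `|ln (t / alpha) - ln (2 ^+ k)| <= ln K + `|ln alpha|.
  rewrite ln_div ?posrE// addrAC.
  apply: le_trans (ler_normB _ _) _; rewrite lerD2r.
  rewrite ler_norml; apply/andP; split.
    rewrite lerBrDl -ln_div ?posrE// ler_ln ?posrE// divr_gt0//.
  by rewrite lerBlDr -lnM ?posrE// ler_ln ?posrE// mulr_gt0.
have ybig : y0 < ln (2 ^+ k) + (a - 1) * m (ln (2 ^+ k)).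
  by near: k; move/cvgryPgt : (cvg_comp _ _ cvgy_ln_exp2 (drift_cvgy (a - 1))); exact.
have ybig' : y0 < ln (2 ^+ k) + a * m (ln (2 ^+ k)).
  by near: k; move/cvgryPgt : (cvg_comp _ _ cvgy_ln_exp2 (drift_cvgy a)); exact.
have C1 : close a b (ln (2 ^+ k)) by near: k.
have C2 : close (a - 1) a (ln (2 ^+ k)) by near: k.
have [h1 h2] := C1 _ _ ty wy; have [h3 _] := C2 _ _ ty wy.
split; first exact: Gle.
by apply: Gle => //; exact: lt_le_trans h3.
Unshelve. all: by end_near. Qed.


(** The interface between paths and probability: each almost sure bound says that [low] holds, or
    fails, eventually or infinitely often. *)
Definition low (a : R) (k : nat) : Prop :=
  forall j, (j < 2 ^ k)%N -> (Y j <= (level a k)%:E)%E.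

Let dyadic (K : R) : 0 < K -> forall k0, \forall t \near +oo,
  exists2 k, (k0 <= k)%N & K * 2 ^+ k <= t <= 2 * K * 2 ^+ k.
Proof.
move=> K0 k0; near=> t.
have t0 : K * 2 ^+ k0 <= t by near: t; apply: nbhs_pinfty_ge; exact: num_real.
have x0 : 2 ^+ k0 <= t / K by rewrite ler_pdivlMr// mulrC.
have xge0 : 0 <= t / K by apply: le_trans x0; rewrite exprn_ge0.
have n0 : (2 ^ k0 <= Num.truncn (t / K))%N by rewrite truncn_ge_nat// natrX.
have npos : (0 < Num.truncn (t / K))%N by apply: leq_trans n0; rewrite expn_gt0.
exists (trunc_log 2 (Num.truncn (t / K))); first exact: trunc_log_max.
have /andP[n1 n2] : (2 ^ trunc_log 2 (Num.truncn (t / K)) <= Num.truncn (t / K)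
    < 2 ^ (trunc_log 2 (Num.truncn (t / K))).+1)%N by exact: trunc_log_bounds.
have /andP[x1 x2] : (Num.truncn (t / K))%:R <= t / K < (Num.truncn (t / K)).+1%:R.
  exact: truncn_itv.
apply/andP; split.
  by rewrite mulrC -ler_pdivlMr//; apply: le_trans x1; rewrite -natrX ler_nat.
rewrite (mulrC 2) -mulrA -exprS mulrC -ler_pdivrMr//.
by apply: ltW; apply: lt_le_trans x2 _; rewrite -natrX ler_nat.
Unshelve. all: by end_near. Qed.

(** By [S_ge], such a [t] is at most [S (2 ^ k)], so only the first [2 ^ k] cycles contribute to
    [Xb t]. The windows span a factor 2 and thus cover all large times. *)
Lemma Xb_le_level (a b : R) : a < b -> \forall k \near \oo, low a k ->
  forall t, c / 2 * 2 ^+ k <= t <= c * 2 ^+ k ->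
  (Xb t <= (G (ln (t / alpha) + b * m (ln t)))%:E)%E.
Proof.
(* This [K] is at least 1 and puts the window inside [[2 ^+ k / K, K * 2 ^+ k]]. *)
move=> ab; pose K := 1 + c + 2 / c.
have c20 : 0 < 2 / c by rewrite divr_gt0.
have K1 : 1 <= K by rewrite /K -addrA lerDl addr_ge0 ?ltW.
have H := level_shift K1 ab.
near=> k => lowk t /andP[t1 t2].
have k0 : (0:R) < 2 ^+ k by rewrite exprn_gt0.
apply: (@le_trans _ _ (level a k)%:E).
  apply: (Xb_le (n := 2 ^ k)); last exact: lowk.
  by apply: le_trans t2 _; near: k.
rewrite lee_fin.
have Hk : forall t, 2 ^+ k / K <= t -> t <= K * 2 ^+ k ->
    level a k <= G (ln (t / alpha) + b * m (ln t)) /\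
    G (ln (t / alpha) + a * m (ln t)) <= level b k by near: k.
have [||] // := Hk t.
  apply: le_trans t1; rewrite [leRHS]mulrC ler_pM2l// -[leLHS]mul1r ler_pdivrMr; last by lra.
  have cc : c / 2 * (2 / c) = 1 by field; rewrite gt_eqF.
  by rewrite /K !mulrDr cc lerDr addr_ge0// !mulr_ge0// ltW.
by apply: le_trans t2 _; rewrite ler_pM2r// /K; lra.
Unshelve. all: by end_near. Qed.

(** By [S_le], the first [2 ^ k] cycles are complete at time [t], and one of them exceeds the
    level. *)
Lemma Xb_ge_level (a b : R) : b < a -> \forall k \near \oo, ~ low a k ->
  forall t, C * 2 ^+ k <= t <= 2 * C * 2 ^+ k ->
  ((G (ln (t / alpha) + b * m (ln t)))%:E <= Xb t)%E.
Proof.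
move=> ab; pose K := 1 + 2 * C + 1 / C.
have C20 : 0 < 1 / C by rewrite divr_gt0.
have K1 : 1 <= K by rewrite /K -addrA lerDl addr_ge0//; [rewrite mulr_ge0// ltW|exact: ltW].
have H := level_shift K1 ab.
near=> k => nlowk t /andP[t1 t2].
have k0 : (0:R) < 2 ^+ k by rewrite exprn_gt0.
have [j jk Yj] : exists2 j, (j < 2 ^ k)%N & ((level a k)%:E <= Y j)%E.
  apply: contrapT => h; apply: nlowk => j jk; rewrite leNgt; apply/negP => Yj.
  by apply: h; exists j => //; exact: ltW.
apply: (@le_trans _ _ (level a k)%:E); last first.
  apply: le_trans Yj _; apply: Xb_ge jk.
  by apply: le_trans t1; near: k.
rewrite lee_fin.
have Hk : forall t, 2 ^+ k / K <= t -> t <= K * 2 ^+ k ->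
    level b k <= G (ln (t / alpha) + a * m (ln t)) /\
    G (ln (t / alpha) + b * m (ln t)) <= level a k by near: k.
have [||] // := Hk t.
  apply: le_trans t1; rewrite [leRHS]mulrC ler_pM2l// -[leLHS]mul1r ler_pdivrMr; last by lra.
  have cc : C * (1 / C) = 1 by field; rewrite gt_eqF.
  by rewrite /K !mulrDr cc lerDr addr_ge0// !mulr_ge0// ltW.
by apply: le_trans t2 _; rewrite ler_pM2r// /K; lra.
Unshelve. all: by end_near. Qed.

(** For [G = gen_inv R0] and [U = hhat R0], the factor [(U (ln (t / alpha)))^-1] is [r0 (A0 t)]. *)
Definition scaled_sup (t : R) : \bar R :=
  (((U (ln (t / alpha)))^-1)%:E * (Xb t - (G (ln (t / alpha)))%:E) / (m (ln t))%:E)%E.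

Lemma scaled_sup_le_near (a e : R) : 0 < e -> (\forall k \near \oo, low a k) ->
  \forall t \near +oo, (scaled_sup t <= (a + e)%:E)%E.
Proof.
(* One half of [e] is spent on passing from the dyadic index to [t], the other on the linearisation
   of [G]. *)
move=> e0 H; have e20 : 0 < e / 2 by rewrite divr_gt0.
have ab : a < a + e / 2 by rewrite ltrDl.
have [N _ HN] : \forall k \near \oo, low a k /\ (low a k ->
  forall t, c / 2 * 2 ^+ k <= t <= c * 2 ^+ k ->
  (Xb t <= (G (ln (t / alpha) + (a + e / 2) * m (ln t)))%:E)%E).
  by near=> k; split; near: k => //; exact: Xb_le_level.
have c20 : 0 < c / 2 by rewrite divr_gt0.
near=> t.
have [k Nk kt] : exists2 k, (N <= k)%N & c / 2 * 2 ^+ k <= t <= 2 * (c / 2) * 2 ^+ k.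
  by near: t; exact: dyadic.
have [lowk Hk] := HN k Nk.
have [+ _] : ((Xb t <= (G (ln (t / alpha) + (a + e / 2) * m (ln t)))%:E ->
  scaled_sup t <= (a + e / 2 + e / 2)%:E) /\
   ((G (ln (t / alpha) + (a + e / 2) * m (ln t)))%:E <= Xb t ->
  (a + e / 2 - e / 2)%:E <= scaled_sup t))%E.
  near: t; apply: filterS (scaled_increment_ereal (a + e / 2) e20) => t; exact.
rewrite -addrA -splitr; apply; apply: Hk => //.
by move: kt; rewrite mulrCA divff// mulr1.
Unshelve. all: by end_near. Qed.

Lemma scaled_sup_ge_near (a e : R) : 0 < e -> (\forall k \near \oo, ~ low a k) ->
  \forall t \near +oo, ((a - e)%:E <= scaled_sup t)%E.
Proof.
move=> e0 H; have e20 : 0 < e / 2 by rewrite divr_gt0.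
have ab : a - e / 2 < a by rewrite ltrBlDr ltrDl.
have [N _ HN] : \forall k \near \oo, ~ low a k /\ (~ low a k ->
  forall t, C * 2 ^+ k <= t <= 2 * C * 2 ^+ k ->
  ((G (ln (t / alpha) + (a - e / 2) * m (ln t)))%:E <= Xb t)%E).
  by near=> k; split; near: k => //; exact: Xb_ge_level.
near=> t.
have [k Nk kt] : exists2 k, (N <= k)%N & C * 2 ^+ k <= t <= 2 * C * 2 ^+ k.
  by near: t; exact: dyadic.
have [lowk Hk] := HN k Nk.
have [_ +] : ((Xb t <= (G (ln (t / alpha) + (a - e / 2) * m (ln t)))%:E ->
  scaled_sup t <= (a - e / 2 + e / 2)%:E) /\
   ((G (ln (t / alpha) + (a - e / 2) * m (ln t)))%:E <= Xb t ->
  (a - e / 2 - e / 2)%:E <= scaled_sup t))%E.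
  near: t; apply: filterS (scaled_increment_ereal (a - e / 2) e20) => t; exact.
rewrite -addrA -opprD -splitr; apply; exact: Hk.
Unshelve. all: by end_near. Qed.

Let frequently_scale (K : R) (Q : nat -> Prop) (Z : R -> Prop) : 0 < K ->
  (forall N, exists2 k, (N <= k)%N & Q k) ->
  (\forall t \near +oo, Z t) -> forall t0 N,
  exists k, [/\ (N <= k)%N, Q k, t0 < K * 2 ^+ k & Z (K * 2 ^+ k)].
Proof.
move=> K0 HQ HZ t0 N.
have Koo : K * 2 ^+ k @[k --> \oo] --> (+oo : set_system R).
  apply/cvgryPge => A; near=> k.
  rewrite mulrC -ler_pdivrMr// -natrX.
  apply: (@le_trans _ _ k%:R); last by rewrite ler_nat ltnW// ltn_expl.
  by near: k; exact: nbhs_infty_ger.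
have [N1 _ HN1] : \forall k \near \oo, t0 < K * 2 ^+ k /\ Z (K * 2 ^+ k).
  by near=> k; split; near: k; [move/cvgryPgt : Koo; exact|exact: Koo].
have [k] := HQ (maxn N N1); rewrite geq_max => /andP[Nk N1k] Qk.
by exists k; have [? ?] := HN1 k N1k; split.
Unshelve. all: by end_near. Qed.

Lemma scaled_sup_ge_frequently (a e : R) : 0 < e -> (forall N, exists2 k, (N <= k)%N & ~ low a k) ->
  forall t0, exists2 t, t0 < t & ((a - e)%:E <= scaled_sup t)%E.
Proof.
move=> e0 H t0; have e20 : 0 < e / 2 by rewrite divr_gt0.
have ab : a - e / 2 < a by rewrite ltrBlDr ltrDl.
have [N _ HN] := Xb_ge_level ab.
have [k [Nk lowk tk hk]] := frequently_scale C0 H (scaled_increment_ereal (a - e / 2) e20) t0 N.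
exists (C * 2 ^+ k) => //.
have := (hk (Xb (C * 2 ^+ k))).2; rewrite -addrA -opprD -splitr; apply.
apply: (HN k) => //; rewrite lexx -mulrA ler_peMl ?ler1n//.
by rewrite mulr_ge0 ?exprn_ge0// ltW.
Qed.

Lemma scaled_sup_le_frequently (a e : R) : 0 < e -> (forall N, exists2 k, (N <= k)%N & low a k) ->
  forall t0, exists2 t, t0 < t & (scaled_sup t <= (a + e)%:E)%E.
Proof.
move=> e0 H t0; have e20 : 0 < e / 2 by rewrite divr_gt0.
have ab : a < a + e / 2 by rewrite ltrDl.
have [N _ HN] := Xb_le_level ab.
have [k [Nk lowk tk hk]] := frequently_scale c0 H (scaled_increment_ereal (a + e / 2) e20) t0 N.
exists (c * 2 ^+ k) => //.
have := (hk (Xb (c * 2 ^+ k))).1; rewrite -addrA -splitr; apply.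
apply: (HN k) => //; rewrite lexx andbT mulrAC ler_pdivrMr// ler_peMr ?ler1n//.
by rewrite mulr_ge0 ?exprn_ge0// ltW.
Qed.

Let small_inv (e : R) : 0 < e -> exists n, n.+1%:R^-1 <= e / 2.
Proof.
move=> e0; have e20 : 0 < e / 2 by rewrite divr_gt0.
have [n _ Hn] := near_infty_natSinv_lt (PosNum e20).
by exists n; apply: ltW; exact: (Hn n (leqnn n)).
Qed.

(** The margins run over the sequence [n.+1%:R^-1] rather than over all positive reals, so that a
    single null set can serve for all of them. *)
Lemma limsup_scaled_sup (a : R) :
  (forall n, \forall k \near \oo, low (a + n.+1%:R^-1) k) ->
  (forall n N, exists2 k, (N <= k)%N & ~ low (a - n.+1%:R^-1) k) ->
  limf_esup scaled_sup (pinfty_nbhs R) = a%:E.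
Proof.
move=> H1 H2; apply: limf_esup_pinfty_eq => e e0; have e20 : 0 < e / 2 by rewrite divr_gt0.
  have [n ne] := small_inv e0.
  apply: filterS (scaled_sup_le_near e20 (H1 n)) => t h; apply: le_trans h _.
  by rewrite lee_fin -addrA lerD2l {2}(splitr e) lerD2r.
have [n ne] := small_inv e0 => t0.
have [t t0t h] := scaled_sup_ge_frequently e20 (H2 n) t0; exists t => //.
by apply: le_trans h; rewrite lee_fin {1}(splitr e) opprD addrA lerD2r lerD2l lerN2.
Qed.

Lemma liminf_scaled_sup (a : R) :
  (forall n, \forall k \near \oo, ~ low (a - n.+1%:R^-1) k) ->
  (forall n N, exists2 k, (N <= k)%N & low (a + n.+1%:R^-1) k) ->
  limf_einf scaled_sup (pinfty_nbhs R) = a%:E.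
Proof.
move=> H1 H2; apply: limf_einf_pinfty_eq => e e0; have e20 : 0 < e / 2 by rewrite divr_gt0.
  have [n ne] := small_inv e0.
  apply: filterS (scaled_sup_ge_near e20 (H1 n)) => t h; apply: le_trans h.
  by rewrite lee_fin {1}(splitr e) opprD addrA lerD2r lerD2l lerN2.
have [n ne] := small_inv e0 => t0.
have [t t0t h] := scaled_sup_le_frequently e20 (H2 n) t0; exists t => //.
by apply: le_trans h _; rewrite lee_fin -addrA lerD2l {2}(splitr e) lerD2r.
Qed.

End deterministic.

(** * Independent sequences *)

Section borel_cantelli.
Context d (T : measurableType d) (R : realType) (P : probability T R).
Variable E : nat -> set T.
Hypothesis mE : forall k, measurable (E k).

Lemma borel_cantelli_ae (u : nat -> R) k0 (C : R) :
  (forall k, (k0 <= k)%N -> (P (E k) <= (u k)%:E)%E) ->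
  (forall n, \sum_(k0 <= k < n) u k <= C) ->
  {ae P, forall w, \forall k \near \oo, ~ E k w}.
Proof.
move=> Pu sumC.
exists (lim_sup_set (fun k => E (k + k0)%N)); split.
- by apply: bigcap_measurable => // n _; apply: bigcup_measurable.
- apply: lim_sup_set_cvg0 => //.
  apply: (@le_lt_trans _ _ C%:E); last exact: ltry.
  apply: lime_le; first by apply: is_cvg_nneseries => *.
  apply: nearW => n.
  apply: (@le_trans _ _ (\sum_(k0 <= k < n + k0) (u k)%:E)%E).
    have -> : (\sum_(k0 <= k < n + k0) (u k)%:E = \sum_(0 <= k < n) (u (k + k0)%N)%:E)%E.
      by rewrite -{1}[k0]add0n big_addn addnK.
    by apply: lee_sum => i _; apply: Pu; rewrite leq_addl.
  by rewrite sumEFin lee_fin.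
- move=> w h n _ /=; apply: contrapT => h2; apply: h.
  exists (n + k0)%N => // k /= nk Ek; apply: h2; exists (k - k0)%N.
    by rewrite /= -(leq_add2r k0) subnK// (leq_trans _ nk)// leq_addl.
  by rewrite subnK// (leq_trans _ nk)// leq_addl.
Qed.

Hypothesis indepE : forall J : seq nat, uniq J ->
  P (\bigcap_(k in [set` J]) E k) = (\prod_(k <- J) P (E k))%E.

Let bigcap_cons (F : nat -> set T) j (J : seq nat) :
  \bigcap_(k in [set` j :: J]) F k = F j `&` \bigcap_(k in [set` J]) F k.
Proof.
apply/seteqP; split => w h.
  by split; [apply: h; rewrite /= mem_head|move=> k kJ; apply: h; rewrite /= inE kJ orbT].
move=> k /=; rewrite inE => /orP[/eqP ->|kJ]; first by case: h.
by case: h => _; exact.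
Qed.

Let measurable_bigcap_seq (F : nat -> set T) (J : seq nat) :
  (forall k, measurable (F k)) -> measurable (\bigcap_(k in [set` J]) F k).
Proof.
move=> mF; elim: J => [|j J IH]; last by rewrite bigcap_cons; exact: measurableI.
rewrite (_ : \bigcap_(k in _) _ = setT)//.
by apply/seteqP; split.
Qed.

Let prob_fin A : measurable A -> P A = (fine (P A))%:E.
Proof. by move=> mA; rewrite fineK// fin_num_measure. Qed.

Lemma independent_compl (J I : seq nat) : uniq (J ++ I) ->
  P ((\bigcap_(k in [set` J]) ~` E k) `&` \bigcap_(k in [set` I]) E k) =
  (\prod_(k <- J) (1 - fine (P (E k))) * \prod_(k <- I) fine (P (E k)))%:E.
Proof.
elim: J I => [|j J IH] I /=.
  move=> uI; rewrite big_nil mul1r (_ : \bigcap_(k in [set` [::]]) _ = setT); last first.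
    by apply/seteqP; split.
  rewrite setTI indepE// (big_morph EFin (@EFinM R) erefl); apply: eq_bigr => k _; exact: prob_fin.
move=> /andP[jJI uJI]; rewrite bigcap_cons big_cons.
set A := \bigcap_(k in [set` J]) _; set B := \bigcap_(k in [set` I]) _.
have mA : measurable A by apply: measurable_bigcap_seq => k; exact: measurableC.
have mB : measurable B by exact: measurable_bigcap_seq.
have -> : ~` E j `&` A `&` B = (A `&` B) `\` E j by rewrite setDE [RHS]setIC setIA.
have mAB : measurable (A `&` B) by exact: measurableI.
have -> : P ((A `&` B) `\` E j) = (P (A `&` B) - P (A `&` B `&` E j))%E.
  by apply: measureD => //; exact: le_lt_trans (probability_le1 P mAB) (ltry 1).
have := IH (j :: I); rewrite bigcap_cons -/A -/B => IHj.
rewrite (_ : A `&` B `&` E j = A `&` (E j `&` B)); last by rewrite -setIA [B `&` _]setIC.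
rewrite IHj; last by rewrite -cat1s uniq_catCA /= jJI.
by rewrite IH// -EFinB big_cons; congr EFin; ring.
Qed.

(** The probability that no [E k] occurs for [N <= k < n] is a product of factors
    [1 - P (E k) <= expR (- p k)], so divergence of the sum drives it to 0. *)
Lemma borel_cantelli2 (p : nat -> R) k0 :
  (forall k, (k0 <= k)%N -> 0 <= p k) ->
  (forall k, (k0 <= k)%N -> ((p k)%:E <= P (E k))%E) ->
  (forall A, exists n, A <= \sum_(k0 <= k < n) p k) ->
  {ae P, forall w, forall N, exists2 k, (N <= k)%N & E k w}.
Proof.
move=> p0 pP pdiv.
pose B N := \bigcap_(k in [set k | (N <= k)%N]) ~` E k.
have mB N : measurable (B N).
  by apply: bigcap_measurable => [|k _]; [exists N => /=|exact: measurableC].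
have B0 N : (k0 <= N)%N -> P (B N) = 0.
  move=> k0N; apply/eqP; rewrite eq_le measure_ge0 andbT.
  apply/lee_addgt0Pr => e e0; rewrite add0e.
  have [n hn] := pdiv (\sum_(k0 <= k < N) p k - ln e).
  have mC : measurable (\bigcap_(k in [set` index_iota N n]) ~` E k).
    by apply: measurable_bigcap_seq => k; exact: measurableC.
  apply: (@le_trans _ _ (P (\bigcap_(k in [set` index_iota N n]) ~` E k))).
    apply: le_measure; rewrite ?inE// => w Bw k /=.
    by rewrite mem_index_iota => /andP[Nk _]; exact: Bw.
  have := @independent_compl (index_iota N n) [::].
  rewrite cats0 big_nil mulr1 (_ : \bigcap_(k in [set` [::]]) _ = setT); last first.
    by apply/seteqP; split.
  rewrite setIT iota_uniq => -> //; rewrite lee_fin.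
  apply: (@le_trans _ _ (expR (- \sum_(N <= k < n) p k))).
    rewrite -sumrN expR_sum big_seq [leRHS]big_seq.
    apply: ler_prod => k; rewrite mem_index_iota => /andP[Nk _].
    have := pP k (leq_trans k0N Nk); rewrite prob_fin// lee_fin => h.
    rewrite subr_ge0 -lee_fin -prob_fin// probability_le1//=.
    by apply: le_trans (expR_ge1Dx _); rewrite lerD2l lerN2.
  rewrite -[leRHS](lnK e0) ler_expR lerNl.
  (* [pdiv] does not ensure [N <= n]. When [n < N], its inequality forces [- ln e <= 0], which is
     the claim for the empty sum. *)
  have [Nn|nN] := leqP N n.
    by move: hn; rewrite (big_cat_nat k0N Nn)/= lerD2l.
  rewrite big_geq ?(ltnW nN)//; move: hn; rewrite lerBlDl => hn.
  suff : \sum_(k0 <= k < n) p k <= \sum_(k0 <= k < N) p k by lra.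
  have [k0n|nk0] := leqP k0 n.
    rewrite (big_cat_nat k0n (ltnW nN))/= lerDl big_seq sumr_ge0// => k.
    by rewrite mem_index_iota => /andP[nk _]; apply: p0; exact: leq_trans nk.
  rewrite big_geq ?(ltnW nk0)// big_seq sumr_ge0// => k.
  by rewrite mem_index_iota => /andP[nk _]; exact: p0.
apply: (@negligibleS _ _ _ P (\bigcup_N B (N + k0)%N)); last first.
  apply: negligible_bigcup => N; exists (B (N + k0)%N); split => //.
  by apply: B0; exact: leq_addl.
move=> w /= h; apply: contrapT => h2; apply: h => N.
apply: contrapT => h3; apply: h2; exists N => // k /= Nk Ek; apply: h3.
by exists k => //; apply: leq_trans Nk; exact: leq_addr.
Qed.
End borel_cantelli.

(** * Linear growth of the regeneration epochs *)

Section second_moment.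
Context d (T : measurableType d) (R : realType) (P : probability T R).
Variables (f : nat -> T -> R) (mu v : R).
Hypotheses (mf : forall i, measurable_fun setT (f i)) (f0 : forall i w, 0 <= f i w).
Hypothesis f_mean : forall i, (\int[P]_w (f i w)%:E = mu%:E)%E.
Hypothesis f_sqr : forall i, (\int[P]_w (f i w * f i w)%:E = v%:E)%E.
Hypothesis f_prod : forall i j, i != j -> (\int[P]_w (f i w * f j w)%:E = (mu * mu)%:E)%E.

Let mu0 : 0 <= mu.
Proof.
by rewrite -lee_fin -(f_mean 0); apply: integral_ge0 => w _; rewrite lee_fin.
Qed.

(** The raw second moment [v] replaces the variance: each row of the double sum has [n - 1]
    off-diagonal terms [mu ^+ 2], and counting [n] of them cancels [(n%:R * mu) ^+ 2] exactly. *)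
Lemma chebyshev_pairwise (n : nat) (a : R) : 0 < a ->
  (P [set w | (a <= `|\sum_(i < n) f i w - n%:R * mu|)%R] <= (n%:R * v / a ^+ 2)%:E)%E.
Proof.
move=> a0.
pose h w := \sum_(i < n) f i w.
pose g w := (h w - n%:R * mu) ^+ 2.
have mh : measurable_fun setT h by apply: measurable_sum => i; exact: mf.
have mg : measurable_fun setT g.
  by apply: measurable_funX; apply: measurable_funB => //; exact: measurable_cst.
have h0 w : 0 <= h w by apply: sumr_ge0 => i _.
have int_h : (\int[P]_w (h w)%:E = (n%:R * mu)%:E)%E.
  under eq_integral do rewrite -sumEFin.
  rewrite ge0_integral_sum//=; last 2 first.
  - by move=> i; exact/measurable_EFinP.
  - by move=> i w _; rewrite lee_fin.
  under eq_bigr do rewrite f_mean.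
  by rewrite sumEFin sumr_const card_ord mulr_natl.
have int_h2 : (\int[P]_w (h w * h w)%:E <= (n%:R * v + n%:R ^+ 2 * mu ^+ 2)%:E)%E.
  under eq_integral.
    move=> w _; rewrite /h big_distrl/=.
    under eq_bigr do rewrite big_distrr/=.
    rewrite -sumEFin.
    over.
  rewrite /= ge0_integral_sum//=; last 2 first.
  - move=> i; apply/measurable_EFinP; apply: measurable_sum => j.
    exact: measurable_funM.
  - by move=> i w _; rewrite lee_fin sumr_ge0// => j _; exact: mulr_ge0.
  apply: (@le_trans _ _ (\sum_(i < n) (v + n%:R * mu ^+ 2)%:E)%E); last first.
    rewrite sumEFin sumr_const card_ord lee_fin -mulr_natl; lra.
  apply: lee_sum => i _.
  under eq_integral do rewrite -sumEFin.
  rewrite ge0_integral_sum//=; last 2 first.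
  - by move=> j; apply/measurable_EFinP; exact: measurable_funM.
  - by move=> j w _; rewrite lee_fin mulr_ge0.
  rewrite (bigD1 i)//= f_sqr EFinD leeD2l//.
  rewrite (eq_bigr (fun=> (mu * mu)%:E)); last first.
    by move=> j ji; rewrite f_prod// eq_sym.
  rewrite sumEFin lee_fin -expr2.
  apply: (@le_trans _ _ (\sum_(j < n) mu ^+ 2)).
    by rewrite [leRHS](bigD1 i)//= lerDr sqr_ge0.
  by rewrite sumr_const card_ord mulr_natl.
have int_g : (\int[P]_w (g w)%:E <= (n%:R * v)%:E)%E.
  (* The square is expanded with the cross term moved to the left, so that all integrands are
     nonnegative; subtraction then takes place between finite numbers. *)
  have : (\int[P]_w (g w)%:E + \int[P]_w (n%:R * mu * 2 * h w)%:E =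
      \int[P]_w (h w * h w)%:E + \int[P]_w ((n%:R * mu) ^+ 2)%:E)%E.
    rewrite -!ge0_integralD//.
    - by apply: eq_integral => w _; rewrite -!EFinD /g; congr EFin; ring.
    - by move=> w _; rewrite lee_fin mulr_ge0.
    - by apply/measurable_EFinP; exact: measurable_funM.
    - by move=> w _; rewrite lee_fin sqr_ge0.
    - by move=> w _; rewrite lee_fin sqr_ge0.
    - exact/measurable_EFinP.
    - by move=> w _; rewrite lee_fin !mulr_ge0.
    - by apply/measurable_EFinP; apply: measurable_funM => //; exact: measurable_cst.
  rewrite integral_cst//= probability_setT mule1.
  under [X in (_ + X = _)%E -> _]eq_integral do rewrite EFinM.
  rewrite ge0_integralZl//; last 3 first.
  - exact/measurable_EFinP.
  - by move=> w _; rewrite lee_fin.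
  - by rewrite lee_fin !mulr_ge0.
  rewrite int_h => e.
  rewrite -(@leeD2rE _ (n%:R * mu * 2 * (n%:R * mu))%:E)// EFinM e.
  apply: le_trans (leeD2r _ int_h2) _.
  by rewrite -!EFinD lee_fin; lra.
have mA : measurable [set w | a <= `|h w - n%:R * mu|].
  rewrite (_ : [set w | _] = (fun w => `|h w - n%:R * mu|) @^-1` `[a, +oo[); last first.
    by apply/seteqP; split => w /=; rewrite in_itv/= andbT.
  rewrite -[X in measurable X]setTI.
  have : measurable_fun setT (fun w => `|h w - n%:R * mu|).
    apply: measurableT_comp => //.
    by apply: measurable_funB => //; exact: measurable_cst.
  by apply.
rewrite EFinM lee_pdivlMr ?exprn_gt0//.
apply: le_trans int_g.
have -> : (P [set w | (a <= `|h w - n%:R * mu|)%R] * (a ^+ 2)%:E =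
   \int[P]_(w in [set w | (a <= `|h w - n%:R * mu|)%R]) (a ^+ 2)%:E)%E.
  by rewrite integral_cst// muleC.
apply: (@le_trans _ _ (\int[P]_(w in [set w | (a <= `|h w - n%:R * mu|)%R]) (g w)%:E)%E).
  apply: ge0_le_integral => //.
  - by move=> w _; rewrite lee_fin sqr_ge0.
  - by apply/measurable_EFinP; exact: measurable_funTS.
  - move=> w /= aw; rewrite lee_fin /g -[leRHS]real_normK ?num_real//.
    by rewrite lerXn2r// nnegrE// ltW.
apply: ge0_subset_integral => //.
- exact/measurable_EFinP.
- by move=> w _; rewrite lee_fin sqr_ge0.
Qed.
End second_moment.

Section independent_sequence.
Context (R : realType) d d' (Omega : measurableType d) (E : measurableType d')
  (P : probability Omega R) (Z : nat -> Omega -> E).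
Hypothesis mZ : forall k, measurable_fun setT (Z k).
Hypothesis indepZ : mutually_independent P Z.

Lemma independent_pair i j (A B : set E) : i != j -> measurable A -> measurable B ->
  P (Z i @^-1` A `&` Z j @^-1` B) = (P (Z i @^-1` A) * P (Z j @^-1` B))%E.
Proof.
move=> ij mA mB.
have := @indepZ [:: i; j] (fun k => if k == i then A else B).
rewrite big_cons big_seq1 eqxx eq_sym (negbTE ij) /= inE ij => <- //; last by move=> k; case: ifP.
congr (P _); apply/seteqP; split => w.
  by move=> [wA wB] k /=; rewrite !inE => /orP[/eqP ->|/eqP ->]; rewrite ?eqxx// eq_sym (negbTE ij).
move=> h; split.
  by have := h i; rewrite /= mem_head eqxx; exact.
by have := h j; rewrite /= !inE eqxx orbT eq_sym (negbTE ij); exact.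
Qed.

(** The joint law of [Z i] and [Z j] agrees with the product of their laws on rectangles, hence
    everywhere, and Tonelli's theorem splits the integral. *)
Lemma independent_integral i j (f g : E -> R) : i != j ->
  measurable_fun setT f -> measurable_fun setT g ->
  (forall x, 0 <= f x) -> (forall x, 0 <= g x) ->
  (\int[P]_w (f (Z i w) * g (Z j w))%:E =
   (\int[P]_w (f (Z i w))%:E) * (\int[P]_w (g (Z j w))%:E))%E.
Proof.
move=> ij mf mg f0 g0.
pose Zi : {mfun Omega >-> E} := HB.pack (Z i) (isMeasurableFun.Build _ _ _ _ _ (mZ i)).
pose Zj : {mfun Omega >-> E} := HB.pack (Z j) (isMeasurableFun.Build _ _ _ _ _ (mZ j)).
have mp : measurable_fun setT (fun w => (Z i w, Z j w)) by exact: measurable_fun_pair.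
pose Zp : {mfun Omega >-> (E * E)%type} :=
  HB.pack (fun w => (Z i w, Z j w)) (isMeasurableFun.Build _ _ _ _ _ mp).
have joint : forall A, measurable A ->
    (distribution P Zi \x distribution P Zj)%E A = distribution P Zp A.
  apply: product_measure_unique => A B mA mB.
  exact: independent_pair.
pose F (x : E * E) := (f x.1 * g x.2)%:E.
have mF : measurable_fun setT F.
  apply/measurable_EFinP; apply: measurable_funM.
    exact: measurableT_comp mf measurable_fst.
  exact: measurableT_comp mg measurable_snd.
have F0 x : (0 <= F x)%E by rewrite lee_fin mulr_ge0.
transitivity (\int[distribution P Zp]_x F x)%E.
  by rewrite ge0_integral_distribution.
transitivity (\int[(distribution P Zi \x distribution P Zj)%E]_x F x)%E.
  by apply: eq_measure_integral => A mA _; apply/esym; exact: joint.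
rewrite fubini_tonelli1// /fubini_F.
transitivity (\int[distribution P Zi]_x ((f x)%:E * \int[P]_w (g (Z j w))%:E))%E.
  apply: eq_integral => x _.
  under eq_integral => y _ do rewrite /F /= EFinM.
  rewrite ge0_integralZl_EFin//; last 2 first.
  - by move=> y _; rewrite lee_fin.
  - exact/measurable_EFinP.
  by rewrite ge0_integral_distribution//; exact/measurable_EFinP.
transitivity ((\int[distribution P Zi]_x (f x)%:E) * (\int[P]_w (g (Z j w))%:E))%E.
  apply: ge0_integralZr => //; first exact/measurable_EFinP.
    by move=> x _; rewrite lee_fin.
  by apply: integral_ge0 => w _; rewrite lee_fin.
by rewrite ge0_integral_distribution//; exact/measurable_EFinP.
Qed.

Hypothesis identZ : identically_distributed P Z.

Lemma identical_integral k (f : E -> R) : measurable_fun setT f ->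
  (forall x, 0 <= f x) ->
  (\int[P]_w (f (Z k w))%:E = \int[P]_w (f (Z 0 w))%:E)%E.
Proof.
move=> mf f0.
pose Z0 : {mfun Omega >-> E} := HB.pack (Z 0) (isMeasurableFun.Build _ _ _ _ _ (mZ 0)).
pose Zk : {mfun Omega >-> E} := HB.pack (Z k) (isMeasurableFun.Build _ _ _ _ _ (mZ k)).
transitivity (\int[distribution P Zk]_x (f x)%:E)%E.
  by rewrite ge0_integral_distribution//; exact/measurable_EFinP.
transitivity (\int[distribution P Z0]_x (f x)%:E)%E.
  by apply: eq_measure_integral => A mA _; exact: identZ.
by rewrite ge0_integral_distribution//; exact/measurable_EFinP.
Qed.

End independent_sequence.

Lemma sum_truncated_sqr_le (R : realType) (x : R) (n : nat) : 0 <= x ->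
  \sum_(k < n) Num.min x (2 ^+ k) ^+ 2 / 2 ^+ k <= 4 * x.
Proof.
move=> x0; pose s n := \sum_(k < n) Num.min x (2 ^+ k) ^+ 2 / 2 ^+ k; rewrite -/(s n).
(* As long as [2 ^+ k < x] the terms are [2 ^+ k]; afterwards they are [x ^+ 2 / 2 ^+ k]. The
   subtracted [2 * x ^+ 2 / 2 ^+ n] is the sum of the geometric tail still to come. *)
have [s1 s2] : s n <= 2 ^+ n /\ (x <= 2 ^+ n -> s n <= 4 * x - 2 * x ^+ 2 / 2 ^+ n).
  elim: n => [|n [IH1 IH2]].
    rewrite /s big_ord0 expr0 ler01 invr1 mulr1; split => // x1.
    by nra.
  have y0 : (0 : R) < 2 ^+ n by rewrite exprn_gt0.
  have sS : s n.+1 = s n + Num.min x (2 ^+ n) ^+ 2 / 2 ^+ n by rewrite /s big_ord_recr.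
  have [xy|yx] := leP x (2 ^+ n).
    have xx : x ^+ 2 / 2 ^+ n <= 2 ^+ n.
      by rewrite ler_pdivrMr// expr2; apply: ler_pM.
    rewrite sS (min_idPl xy); split => [|_].
      by rewrite [leRHS]exprS; lra.
    have := IH2 xy; rewrite [2 ^+ n.+1]exprS.
    have -> : 2 * x ^+ 2 / (2 * 2 ^+ n) = x ^+ 2 / 2 ^+ n by field; rewrite gt_eqF.
    by lra.
  rewrite sS (min_idPr (ltW yx)) expr2 mulfK ?gt_eqF//; split => [|xy].
    by rewrite [leRHS]exprS; lra.
  have h : s n + 2 ^+ n <= 2 ^+ n.+1 by rewrite [leRHS]exprS; lra.
  apply: le_trans h _; set y := 2 ^+ n.+1 in xy *.
  have yE : y = 2 * 2 ^+ n by rewrite /y exprS.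
  have y0' : 0 < y by lra.
  have q : y * (2 * x ^+ 2 / y) = 2 * x ^+ 2 by field; rewrite gt_eqF.
  (* Crossing step, where [y / 2 < x <= y]: adding [c2] yields
     [y ^+ 2 <= 4 * x * y - 2 * x ^+ 2]. *)
  have c1 : 0 <= (y - x) * (2 * x - y) by apply: mulr_ge0; lra.
  have c2 : 0 <= x * y by rewrite mulr_ge0// ltW.
  by rewrite -(ler_pM2l y0') mulrBr q; lra.
have [xn|nx] := leP x (2 ^+ n).
  apply: le_trans (s2 xn) _; rewrite lerBlDr lerDl divr_ge0 ?mulr_ge0 ?exprn_ge0//.
by apply: le_trans s1 _; lra.
Qed.

Lemma integral_gt0 d (T : measurableType d) (R : realType) (P : probability T R)
  (f : T -> R) : measurable_fun setT f -> (forall w, 0 < f w) ->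
  (0 < \int[P]_w (f w)%:E)%E.
Proof.
move=> mf f0; rewrite lt_neqAle integral_ge0 ?andbT; last first.
  by move=> w _; rewrite lee_fin ltW.
apply/negP => /eqP int0.
have : (\int[P]_w `|(f w)%:E| = 0)%E.
  by under eq_integral do rewrite gee0_abs ?lee_fin ?ltW//.
have mE : measurable_fun setT (fun w => (f w)%:E) by exact/measurable_EFinP.
move=> /(ae_eq_integral_abs P measurableT mE) [N [mN PN0 subN]].
have : (P setT <= P N)%E.
  apply: le_measure; rewrite ?inE// => w _; apply: subN => /= /(_ I) [].
  by apply/eqP; rewrite gt_eqF.
by rewrite PN0 probability_setT lee_fin ler10.
Qed.

Section linear_growth.
Context (R : realType) d d' (Omega : measurableType d) (E : measurableType d')
  (P : probability Omega R) (Z : nat -> Omega -> E) (tau : E -> R).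
Hypothesis mZ : forall k, measurable_fun setT (Z k).
Hypothesis indepZ : mutually_independent P Z.
Hypothesis identZ : identically_distributed P Z.
Hypothesis mtau : measurable_fun setT tau.
Hypothesis tau0 : forall x, 0 <= tau x.
Hypothesis tauZ : forall w, 0 < tau (Z 0 w).
Hypothesis tau_int : (\int[P]_w (tau (Z 0 w))%:E < +oo)%E.

Let f k x := Num.min (tau x) (2 ^+ k).
Let mf k : measurable_fun setT (f k).
Proof. by apply: measurable_minr => //; exact: measurable_cst. Qed.
Let f0 k x : 0 <= f k x.
Proof. by rewrite le_min tau0 exprn_ge0. Qed.
Let f_tau k x : f k x <= tau x.
Proof. by rewrite ge_min lexx. Qed.
Let mfZ k i : measurable_fun setT (fun w => f k (Z i w)).
Proof. exact: measurableT_comp. Qed.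
Let mtauZ i : measurable_fun setT (fun w => tau (Z i w)).
Proof. exact: measurableT_comp. Qed.

Let alpha := fine (\int[P]_w (tau (Z 0 w))%:E).
Let alphaE : (\int[P]_w (tau (Z 0 w))%:E)%E = alpha%:E.
Proof.
rewrite fineK// ge0_fin_numE// integral_ge0// => w _.
by rewrite lee_fin.
Qed.

Let mean k := fine (\int[P]_w (f k (Z 0 w))%:E).
Let mean_le k : (\int[P]_w (f k (Z 0 w))%:E <= alpha%:E)%E.
Proof.
rewrite -alphaE; apply: ge0_le_integral => //.
- by move=> w _; rewrite lee_fin.
- exact/measurable_EFinP.
- exact/measurable_EFinP.
- by move=> w _; rewrite lee_fin.
Qed.
Let meanE k : (\int[P]_w (f k (Z 0 w))%:E)%E = (mean k)%:E.
Proof.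
rewrite fineK// ge0_fin_numE; first exact: le_lt_trans (mean_le k) (ltry _).
by apply: integral_ge0 => w _; rewrite lee_fin.
Qed.

Let mean0_gt0 : 0 < mean 0.
Proof.
rewrite -lte_fin -meanE; apply: integral_gt0 => // w.
by rewrite lt_min tauZ expr0 ltr01.
Qed.

Let mean0_le k : mean 0 <= mean k.
Proof.
rewrite -lee_fin -!meanE; apply: ge0_le_integral => //.
- by move=> w _; rewrite lee_fin.
- exact/measurable_EFinP.
- exact/measurable_EFinP.
- move=> w _; rewrite lee_fin le_min f_tau/= ge_min expr0.
  by rewrite exprn_ege1 ?orbT// ler1n.
Qed.

(** This one quantity bounds both bad events at scale [2 ^+ k]: it dominates
    [2 ^+ k * P (tau > 2 ^+ k)], the union bound for [large k], and up to a constant it is the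
    Chebyshev bound for [far k]. *)
Let wt k := fine (\int[P]_w (f k (Z 0 w) ^+ 2 / 2 ^+ k)%:E).
Let mg k i : measurable_fun setT (fun w => f k (Z i w) ^+ 2 / 2 ^+ k).
Proof. by apply: measurable_funM; [exact: measurable_funX|exact: measurable_cst]. Qed.
Let g0 k i w : 0 <= f k (Z i w) ^+ 2 / 2 ^+ k.
Proof. by rewrite divr_ge0 ?sqr_ge0 ?exprn_ge0. Qed.
Let wtE k : (\int[P]_w (f k (Z 0 w) ^+ 2 / 2 ^+ k)%:E)%E = (wt k)%:E.
Proof.
rewrite fineK// ge0_fin_numE; last first.
  by apply: integral_ge0 => w _; rewrite lee_fin g0.
apply: le_lt_trans (ltry alpha); rewrite -alphaE; apply: ge0_le_integral => //.
- by move=> w _; rewrite lee_fin g0.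
- exact/measurable_EFinP.
- exact/measurable_EFinP.
- move=> w _; rewrite lee_fin ler_pdivrMr ?exprn_gt0// expr2.
  by apply: ler_pM => //; rewrite ge_min lexx orbT.
Qed.

Let sum_wt n : \sum_(0 <= k < n) wt k <= 4 * alpha.
Proof.
rewrite big_mkord -lee_fin -sumEFin.
under eq_bigr do rewrite -wtE.
rewrite -ge0_integral_sum//=; last 2 first.
- by move=> k; exact/measurable_EFinP.
- by move=> k w _; rewrite lee_fin g0.
rewrite EFinM -alphaE -ge0_integralZl_EFin//; last 2 first.
- by move=> w _; rewrite lee_fin.
- exact/measurable_EFinP.
apply: ge0_le_integral => //.
- by move=> w _; apply: sume_ge0 => k _; rewrite lee_fin g0.
- by apply: emeasurable_sum => k; exact/measurable_EFinP.
- by apply/measurable_EFinP; apply: measurable_funM => //; exact: measurable_cst.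
- by move=> w _; rewrite sumEFin -EFinM lee_fin; exact: sum_truncated_sqr_le.
Qed.

Let large k :=
  \bigcup_(i in [set i | (i < 2 ^ k)%N]) (fun w => tau (Z i w)) @^-1` `]2 ^+ k, +oo[.
Let far k := [set w | mean 0 / 2 * 2 ^+ k <=
  `|\sum_(i < 2 ^ k) f k (Z i w) - (2 ^ k)%:R * mean k|].

Let mlarge k : measurable (large k).
Proof.
by apply: bigcup_measurable => i _; rewrite -[X in measurable X]setTI; exact: mtauZ.
Qed.

Let mfar k : measurable (far k).
Proof.
rewrite (_ : far k = (fun w => `|\sum_(i < 2 ^ k) f k (Z i w) - (2 ^ k)%:R * mean k|) @^-1`
  `[mean 0 / 2 * 2 ^+ k, +oo[); last first.
  by apply/seteqP; split => w /=; rewrite in_itv/= andbT.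
have m : measurable_fun setT (fun w => `|\sum_(i < 2 ^ k) f k (Z i w) - (2 ^ k)%:R * mean k|).
  apply: measurableT_comp => //; apply: measurable_funB; last exact: measurable_cst.
  by apply: measurable_sum => i; exact: mfZ.
by rewrite -[X in measurable X]setTI; exact: m.
Qed.

Let P_large k : (P (large k) <= (wt k)%:E)%E.
Proof.
pose F i := (fun w => tau (Z i w)) @^-1` `]2 ^+ k, +oo[.
have mF i : measurable (F i) by rewrite -[X in measurable X]setTI; exact: mtauZ.
have -> : large k = \big[setU/set0]_(i < 2 ^ k) F i by rewrite -bigcup_mkord.
apply: (@le_trans _ _ (\sum_(i < 2 ^ k) P (F i))%E).
  exact: (Boole_inequality P (fun i _ => mF i)).
have PF i : P (F i) = P (F 0%N).
  have mt : measurable (tau @^-1` `]2 ^+ k, +oo[).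
    by rewrite -[X in measurable X]setTI; exact: mtau.
  exact: (identZ i mt).
have PE : P (F 0%N) = (fine (P (F 0%N)))%:E by rewrite fineK// fin_num_measure.
under eq_bigr do rewrite PF PE.
rewrite sumEFin sumr_const card_ord -wtE -[_ *+ (2 ^ k)]mulr_natl natrX EFinM -PE.
rewrite -(integral_cst P (mF 0%N)).
apply: (@le_trans _ _ (\int[P]_(w in F 0%N) (f k (Z 0 w) ^+ 2 / 2 ^+ k)%:E)%E).
  apply: ge0_le_integral => //.
  - by move=> w _; rewrite lee_fin exprn_ge0.
  - by apply/measurable_EFinP; exact: measurable_funTS.
  - move=> w; rewrite /F /= in_itv/= andbT => h.
    by rewrite lee_fin /f (min_idPr (ltW h)) expr2 mulfK// expf_neq0.
apply: ge0_subset_integral => //.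
- exact/measurable_EFinP.
- by move=> w _; rewrite lee_fin g0.
Qed.

Let P_far k : (P (far k) <= (4 / mean 0 ^+ 2 * wt k)%:E)%E.
Proof.
have a0 : 0 < mean 0 / 2 * 2 ^+ k by rewrite mulr_gt0 ?divr_gt0 ?exprn_gt0.
apply: le_trans (@chebyshev_pairwise _ _ _ P (fun i w => f k (Z i w)) (mean k) (wt k * 2 ^+ k)
  _ _ _ _ _ (2 ^ k)%N _ a0) _.
- by move=> i; exact: mfZ.
- by move=> i w; exact: f0.
- by move=> i; rewrite -meanE; exact: identical_integral.
- move=> i.
  rewrite (@identical_integral _ _ _ _ _ _ _ mZ identZ i (fun x => f k x * f k x))//; last 2 first.
  + exact: measurable_funM.
  + by move=> x; exact: mulr_ge0.
  rewrite EFinM -wtE muleC -ge0_integralZl_EFin ?exprn_ge0//; last 2 first.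
  + by move=> w _; rewrite lee_fin g0.
  + exact/measurable_EFinP.
  apply: eq_integral => w _; rewrite -EFinM; congr EFin.
  by field; rewrite expf_neq0.
- move=> i j ij; rewrite independent_integral//.
  by rewrite !identical_integral// meanE -EFinM.
rewrite lee_fin natrX le_eqVlt; apply/orP; left; apply/eqP.
by field; rewrite expf_neq0// gt_eqF.
Qed.

(* Chebyshev's inequality for the lengths truncated at [2 ^+ k]: the error terms
   [wt k] are summable because [sum_k min(x, 2^k)^2 / 2^k <= 4 x]. *)
Lemma linear_growth : exists c C : R, [/\ 0 < c, 0 < C &
  {ae P, forall w, \forall k \near \oo,
    c * 2 ^+ k <= \sum_(i < 2 ^ k) tau (Z i w) <= C * 2 ^+ k}].
Proof.
(* Off the bad events the sum is within [mean 0 / 2 * 2 ^+ k] of [2 ^+ k * mean k], and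
   [mean 0 <= mean k <= alpha]. *)
exists (mean 0 / 2), (alpha + mean 0).
have alpha_ge0 : 0 <= alpha.
  by rewrite -lee_fin -alphaE; apply: integral_ge0 => w _; rewrite lee_fin.
have mean_alpha k : mean k <= alpha by rewrite -lee_fin -meanE.
split; [by rewrite divr_gt0|by rewrite ltr_wpDl|].
have : {ae P, forall w, \forall k \near \oo, ~ (large k `|` far k) w}.
  apply: (@borel_cantelli_ae _ _ _ P _ _ (fun k => (1 + 4 / mean 0 ^+ 2) * wt k) 0
    ((1 + 4 / mean 0 ^+ 2) * (4 * alpha))).
  - by move=> k; exact: measurableU.
  - move=> k _; apply: le_trans (measureU2 _ _ _) _ => //.
    by rewrite mulrDl mul1r EFinD; apply: leeD; [exact: P_large|exact: P_far].
  - move=> n; rewrite -mulr_sumr ler_pM2l//.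
    by rewrite ltr_pwDl// divr_ge0// sqr_ge0.
apply: filterS => w; apply: filterS => k /not_orP [nl nf].
have S_eq : \sum_(i < 2 ^ k) f k (Z i w) = \sum_(i < 2 ^ k) tau (Z i w).
  apply: eq_bigr => i _; rewrite /f; apply/min_idPl; rewrite leNgt; apply/negP => h.
  by apply: nl; exists i => /=; rewrite ?in_itv/= ?h.
move/negP : nf; rewrite -ltNge S_eq ltr_norml natrX => /andP[h1 h2].
have p0 : (0:R) < 2 ^+ k by rewrite exprn_gt0.
have e1 : 2 ^+ k * mean 0 <= 2 ^+ k * mean k by rewrite ler_pM2l.
have e2 : 2 ^+ k * mean k <= 2 ^+ k * alpha by rewrite ler_pM2l.
have e3 : 0 < mean 0 * 2 ^+ k by exact: mulr_gt0.
by apply/andP; split; lra.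
Qed.

End linear_growth.

(** * Maxima of independent cycles *)

Section sums.
Variable R : realType.

(** The terms [(k + 1) ^ - (1 + e)] are compared with the decrements of [b k = k ^ - e], which
    telescope. *)
Lemma sum_expRN_ln_le (e : R) (n : nat) : 0 < e ->
  \sum_(1 <= k < n) expR (- ((1 + e) * ln k.+1%:R)) <= e^-1.
Proof.
move=> e0; pose b (k : nat) := expR (- (e * ln k%:R)).
have step k : (0 < k)%N -> expR (- ((1 + e) * ln k.+1%:R)) <= e^-1 * (b k - b k.+1).
  move=> k0; have k0' : 0 < k%:R :> R by rewrite ltr0n.
  have k1' : 0 < k.+1%:R :> R by rewrite ltr0n.
  rewrite ler_pdivlMl// mulrDl mul1r opprD expRD expRN lnK ?posrE// -/(b k.+1).
  have -> : b k = b k.+1 * expR (e * (ln k.+1%:R - ln k%:R)).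
    by rewrite /b -expRD; congr expR; ring.
  have h1 := expR_ge1Dx (e * (ln k.+1%:R - ln k%:R : R)).
  have h2 : k.+1%:R^-1 <= ln k.+1%:R - ln k%:R :> R.
    have := ln_sub_le k0' k1'.
    rewrite -[k.+1%:R]natr1 opprD addrA subrr sub0r mulN1r lerNr opprB => h.
    by rewrite natr1 in h *.
  have b0 : 0 < b k.+1 by exact: expR_gt0.
  rewrite -[X in _ <= _ - X]mulr1 -mulrBr mulrA [leLHS]mulrC ler_pM2l//.
  by rewrite lerBrDl; apply: le_trans h1; rewrite lerD2l ler_pM2l.
rewrite -[leRHS]mulr1.
apply: (@le_trans _ _ (\sum_(1 <= k < n) e^-1 * (b k - b k.+1))).
  rewrite big_seq [leRHS]big_seq; apply: ler_sum => k.
  by rewrite mem_index_iota => /andP[k0 _]; exact: step.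
rewrite -mulr_sumr ler_pM2l ?invr_gt0//.
have [n1|n1] := leqP n 1; first by rewrite big_geq// ler01.
under eq_bigr do rewrite -opprB.
rewrite sumrN telescope_sumr ?(ltnW n1)// opprB /b ln1 mulr0 oppr0 expR0.
by rewrite gerBl expR_ge0.
Qed.

Lemma harmonic_unbounded (A : R) (k0 : nat) : exists n,
  A <= \sum_(k0 <= k < n) k.+1%:R^-1.
Proof.
have step k : ln k.+2%:R - ln k.+1%:R <= k.+1%:R^-1 :> R.
  have := @ln_sub_le R k.+2%:R k.+1%:R (ltr0Sn _ _) (ltr0Sn _ _).
  by rewrite -[k.+2%:R]natr1 [_ - k.+1%:R]addrAC subrr add0r mul1r natr1.
have [n [kn hn]] : exists n, (k0 <= n)%N /\ A + ln k0.+1%:R <= ln n.+1%:R.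
  have /cvgryPge /(_ (A + ln k0.+1%:R)) := @cvgy_ln R.
  move=> [X [_ HX]].
  exists (maxn k0 (Num.truncn `|X|).+1); split; first exact: leq_maxl.
  apply: HX; apply: le_lt_trans (ler_norm X) _.
  apply: lt_le_trans (truncnS_gt _) _.
  by rewrite ler_nat leqW// leq_maxr.
exists n; apply: (@le_trans _ _ (\sum_(k0 <= k < n) (ln k.+2%:R - ln k.+1%:R))).
  by rewrite (telescope_sumr (fun k => ln k.+1%:R)) // lerBrDr.
by apply: ler_sum => k _; exact: step.
Qed.

(** The summand is [c / (j * ln j)] with [j = k + 2], at least [c] times an increment of
    [ln (ln j)]. Starting at [j = 2] keeps [ln j] positive. *)
Lemma sum_inv_nln_unbounded (A c : R) (k0 : nat) : 0 < c -> exists n,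
  A <= \sum_(k0 <= k < n) c * expR (- (ln k.+2%:R + ln (ln k.+2%:R))).
Proof.
move=> c0; pose l (k : nat) : R := ln (ln k%:R).
have ln0 k : 0 < ln k.+2%:R :> R by rewrite ln_gt0// ltr1n.
have step k : l k.+3 - l k.+2 <= expR (- (ln k.+2%:R + ln (ln k.+2%:R))).
  apply: le_trans (ln_sub_le (ln0 _) (ln0 _)) _.
  rewrite opprD expRD !expRN !lnK ?posrE// ler_pM2r ?invr_gt0//.
  have := @ln_sub_le R k.+3%:R k.+2%:R (ltr0Sn _ _) (ltr0Sn _ _).
  by rewrite -[k.+3%:R]natr1 [_ - k.+2%:R]addrAC subrr add0r mul1r natr1.
have [n [kn hn]] : exists n, (k0 <= n)%N /\ A / c + l k0.+2 <= l n.+2.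
  have /cvgryPge /(_ (A / c + l k0.+2)) := cvg_comp _ _ (@cvgy_ln R) (@cvgy_ln R).
  move=> [X [_ HX]].
  exists (maxn k0 (Num.truncn `|X|).+1); split; first exact: leq_maxl.
  apply: HX; apply: le_lt_trans (ler_norm X) _.
  apply: lt_le_trans (truncnS_gt _) _.
  by rewrite ler_nat 2?leqW// leq_maxr.
exists n; rewrite -mulr_sumr mulrC -ler_pdivrMr//.
apply: (@le_trans _ _ (\sum_(k0 <= k < n) (l k.+3 - l k.+2))).
  by rewrite (telescope_sumr (fun k => l k.+2)) // lerBrDr.
by apply: ler_sum => k _; exact: step.
Qed.
End sums.

Section blocks.
Context (R : realType) d d' (Omega : measurableType d) (E : measurableType d')
  (P : probability Omega R) (Z : nat -> Omega -> E).
Hypothesis mZ : forall k, measurable_fun setT (Z k).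
Hypothesis indepZ : mutually_independent P Z.
Variables (B : nat -> seq nat) (A : nat -> set E).
Hypothesis uB : forall k, uniq (B k).
Hypothesis dB : forall k l j, j \in B k -> j \in B l -> k = l.
Hypothesis mA : forall k, measurable (A k).

Let block k := \bigcap_(j in [set` B k]) Z j @^-1` A k.

Lemma measurable_block k : measurable (block k).
Proof.
apply: bigcap_measurableType => j _.
by rewrite -[X in measurable X]setTI; exact: mZ.
Qed.

(** Disjointness of the blocks makes this an inverse of membership, so that one family
    [A (owner j)], indexed by cycles as [mutually_independent] demands, describes all blocks at
    once. *)
Let owner j := xget 0 [set k | j \in B k].
Let ownerE k j : j \in B k -> owner j = k.
Proof. by move=> jk; apply: xget_unique => // l /= jl; exact: dB jl jk. Qed.

Let uniq_blocks (J : seq nat) : uniq J -> uniq (flatten [seq B k | k <- J]).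
Proof.
elim: J => //= k J IH /andP[kJ uJ]; rewrite cat_uniq uB IH// andbT /=.
apply/hasPn => j /flatten_mapP[l lJ jl]; apply/negP => jk.
by move: kJ; rewrite (dB jk jl) lJ.
Qed.

Lemma prob_block k : P (block k) = (\prod_(j <- B k) P (Z j @^-1` A k))%E.
Proof. exact: (indepZ (A := fun=> A k)). Qed.

Lemma independent_blocks (J : seq nat) : uniq J ->
  P (\bigcap_(k in [set` J]) block k) = (\prod_(k <- J) P (block k))%E.
Proof.
move=> uJ.
have -> : \bigcap_(k in [set` J]) block k =
  \bigcap_(j in [set` flatten [seq B k | k <- J]]) Z j @^-1` A (owner j).
  apply/seteqP; split => w h.
    by move=> j /= /flatten_mapP[k kJ jk]; rewrite (ownerE jk); exact: (h k kJ j jk).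
  move=> k /= kJ j /= jk; rewrite -(ownerE jk); apply: h => /=.
  by apply/flatten_mapP; exists k.
rewrite (indepZ (A := fun j => A (owner j)))//; last exact: uniq_blocks.
rewrite big_flatten big_map; apply: eq_bigr => k _; rewrite prob_block.
by rewrite big_seq [RHS]big_seq; apply: eq_bigr => j jk; rewrite (ownerE jk).
Qed.
End blocks.

(** * Almost sure bounds for the dyadic maxima *)

Section extremes.
Context (R : realType) d d' (Omega : measurableType d) (E : measurableType d')
  (P : probability Omega R) (Z : nat -> Omega -> E) (M : E -> \bar R).
Hypothesis mZ : forall k, measurable_fun setT (Z k).
Hypothesis indepZ : mutually_independent P Z.
Hypothesis identZ : identically_distributed P Z.
Hypothesis mM : measurable_fun setT M.
Variables (G : R -> R) (C1 z0 : R).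

Definition below (x : R) : set E := [set c | (M c <= x%:E)%E].

Let tail z := fine (P (Z 0 @^-1` ~` below (G z))).

Hypothesis tail_ge : forall z, z0 < z -> ((expR (- C1 - z))%:E <= P (Z 0 @^-1` ~` below (G z)))%E.
Hypothesis tail_le : forall z, z0 < z -> (P (Z 0 @^-1` ~` below (G z)) <= (expR (C1 - z))%:E)%E.

Lemma measurable_below x : measurable (below x).
Proof.
by rewrite -[below x]setTI; exact: emeasurable_fun_infty_c.
Qed.

Let mpre k A : measurable A -> measurable (Z k @^-1` A).
Proof. by move=> mA; rewrite -[X in measurable X]setTI; exact: mZ. Qed.

Let tailE k z : P (Z k @^-1` ~` below (G z)) = (tail z)%:E.
Proof.
rewrite (identZ k (measurableC (measurable_below (G z)))) fineK// fin_num_measure//.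
by apply: mpre; exact: measurableC (measurable_below _).
Qed.

Let tail01 z : 0 <= tail z <= 1.
Proof.
have m : measurable (Z 0 @^-1` ~` below (G z)).
  by apply: mpre; exact: measurableC (measurable_below _).
by rewrite -!lee_fin -(tailE 0) measure_ge0 probability_le1.
Qed.

Let belowE k z : P (Z k @^-1` below (G z)) = (1 - tail z)%:E.
Proof.
have m : measurable (Z k @^-1` ~` below (G z)).
  by apply: mpre; exact: measurableC (measurable_below _).
have -> : Z k @^-1` below (G z) = ~` (Z k @^-1` ~` below (G z)).
  by rewrite preimage_setC setCK.
by rewrite probability_setC// tailE.
Qed.

Let n2 k : R := ln (2 ^+ k).

Lemma prob_all_below (B : seq nat) z : uniq B ->
  P (\bigcap_(j in [set` B]) Z j @^-1` below (G z)) = ((1 - tail z) ^+ size B)%:E.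
Proof.
move=> uB; rewrite (indepZ (A := fun=> below (G z)))//; last first.
  by move=> _; exact: measurable_below.
under eq_bigr do rewrite belowE.
rewrite -(big_morph EFin (@EFinM R) erefl).
by rewrite big_const_seq count_predT -Monoid.iteropE.
Qed.

Lemma prob_not_all_below (n : nat) z :
  (P (~` \bigcap_(j in `I_n) Z j @^-1` below (G z)) <= (n%:R * tail z)%:E)%E.
Proof.
rewrite setC_bigcap bigcup_mkord.
apply: (@le_trans _ _ (\sum_(i < n) P (Z i @^-1` ~` below (G z)))%E).
  exact: (Boole_inequality P (fun i _ => mpre i (measurableC (measurable_below _)))).
under eq_bigr do rewrite tailE.
by rewrite sumEFin sumr_const card_ord mulr_natl.
Qed.

Lemma low_setE (m : R -> R) a k :
  [set w | low G m (fun j => M (Z j w)) a k] =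
  \bigcap_(j in `I_(2 ^ k)) Z j @^-1` below (G (n2 k + a * m (n2 k))).
Proof. by []. Qed.


Let n2oo : n2 k @[k --> \oo] --> (+oo : set_system R).
Proof. exact: cvgy_ln_exp2. Qed.

Let expR_n2 k : expR (n2 k) = 2 ^+ k.
Proof. by rewrite /n2 lnK// posrE exprn_gt0. Qed.

Lemma scaled_tail_le m a : slow m -> \forall k \near \oo,
  2 ^+ k * tail (n2 k + a * m (n2 k)) <= expR (C1 - a * m (n2 k)).
Proof.
move=> sm; near=> k.
have z : z0 < n2 k + a * m (n2 k).
  by near: k; move/cvgryPgt : (cvg_comp _ _ n2oo (drift_cvgy sm a)); exact.
have := tail_le z; rewrite tailE lee_fin => h.
rewrite -expR_n2 -ler_pdivlMl ?expR_gt0// -expRN -expRD.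
by apply: le_trans h _; rewrite ler_expR; lra.
Unshelve. all: by end_near. Qed.

Lemma scaled_tail_ge m a : slow m -> \forall k \near \oo,
  expR (- C1 - a * m (n2 k)) <= 2 ^+ k * tail (n2 k + a * m (n2 k)).
Proof.
move=> sm; near=> k.
have z : z0 < n2 k + a * m (n2 k).
  by near: k; move/cvgryPgt : (cvg_comp _ _ n2oo (drift_cvgy sm a)); exact.
have := tail_ge z; rewrite tailE lee_fin => h.
rewrite -expR_n2 -ler_pdivrMl ?expR_gt0// -expRN -expRD.
by apply: le_trans h; rewrite ler_expR; lra.
Unshelve. all: by end_near. Qed.

Let Y w j := M (Z j w).

Let measurable_low m a k : measurable [set w | low G m (Y w) a k].
Proof.
rewrite low_setE; apply: bigcap_measurableType => j _.
by apply: mpre; exact: measurable_below.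
Qed.

(** [n2 k.+1] is [k.+1 * ln 2]. The index 0, where [n2] vanishes, is left out, whence the events
    indexed by [k.+1] below. *)
Let ln_n2S k : ln (n2 k.+1) = ln k.+1%:R + ln (ln 2).
Proof. by rewrite /n2 lnXn// -[_ *+ k.+1]mulr_natl lnM ?posrE ?ltr0n// ln_gt0// ltr1n. Qed.

(** Union bound: some cycle among the first [2 ^ k] exceeds the level with probability at most
    [expR C1 * (k * ln 2) ^ - (1 + e)], which is summable. *)
Lemma eventually_low_ln e : 0 < e ->
  {ae P, forall w, \forall k \near \oo, low G (@ln R) (Y w) (1 + e) k}.
Proof.
move=> e0; pose K := expR (C1 - (1 + e) * ln (ln 2)).
have [N _ HN] := scaled_tail_le (1 + e) (slow_ln R).
have : {ae P, forall w, \forall k \near \oo, ~ (~` [set w | low G (@ln R) (Y w) (1 + e) k.+1]) w}.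
  apply: (@borel_cantelli_ae _ _ _ P _ _ (fun k => K * expR (- ((1 + e) * ln k.+1%:R))) (maxn 1 N)
    (K * e^-1)).
  - by move=> k; apply: measurableC; exact: measurable_low.
  - move=> k; rewrite geq_max => /andP[k1 Nk]; rewrite low_setE.
    apply: le_trans (prob_not_all_below _ _) _; rewrite lee_fin natrX.
    apply: le_trans (HN k.+1 (leqW Nk)) _.
    by rewrite /K -expRD ler_expR ln_n2S; lra.
  - move=> n; rewrite -mulr_sumr ler_pM2l ?expR_gt0//.
    apply: le_trans (sum_expRN_ln_le n e0).
    have [nN|Nn] := leqP n (maxn 1 N).
      by rewrite big_geq// sumr_ge0// => k _; exact: expR_ge0.
    rewrite [leRHS](@big_cat_nat _ _ _ (maxn 1 N))/= ?leq_maxl ?(ltnW Nn)//.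
    by rewrite lerDr sumr_ge0// => k _; exact: expR_ge0.
apply: filterS => w [k0 _ H]; exists k0.+1 => // -[//|k] /= k0k.
by apply: contrapT; exact: H.
Qed.

Let lnln (y : R) := ln (ln y).
Let slow_lnln : slow lnln. Proof. exact: slow_ln_comp (slow_ln R). Qed.

(** By independence [low] has probability at most [expR (- (2 ^+ k * tail))]. The exponent is of
    order at least [(ln (n2 k)) ^ (1 + e)], hence exceeds [2 * ln (n2 k)], and the probability is at
    most [n2 k ^ - 2]. *)
Lemma eventually_not_low_lnln e : 0 < e ->
  {ae P, forall w, \forall k \near \oo, ~ low G lnln (Y w) (- 1 - e) k}.
Proof.
move=> e0.
have lln2 : ln (ln (n2 k)) @[k --> \oo] --> (+oo : set_system R).
  exact: (cvg_comp _ _ (cvg_comp _ _ n2oo (@cvgy_ln R)) (@cvgy_ln R)).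
have : \forall k \near \oo,
    expR (2 * ln (n2 k)) * fine (P [set w | low G lnln (Y w) (- 1 - e) k]) <= 1.
  near=> k.
  rewrite low_setE -[X in \bigcap_(j in X) _](_ : [set` index_iota 0 (2 ^ k)] = _); last first.
    by apply/seteqP; split => j /=; rewrite mem_index_iota.
  rewrite prob_all_below ?iota_uniq// size_iota subn0 /=.
  set t := tail _.
  have /andP[t0 t1] : 0 <= t <= 1 by exact: tail01.
  have h1 : (1 - t) ^+ (2 ^ k) <= expR (- (2 ^+ k * t)).
    rewrite -natrX -mulrN expRM_natl lerXn2r ?nnegrE ?subr_ge0 ?expR_ge0//.
    exact: expR_ge1Dx.
  have h2 : expR (- C1 - (- 1 - e) * lnln (n2 k)) <= 2 ^+ k * t.
    by rewrite /t; near: k; exact: scaled_tail_ge.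
  have u0 : 0 < ln (n2 k).
    by near: k; move/cvgryPgt : (cvg_comp _ _ n2oo (@cvgy_ln R)); exact.
  have h3 : (C1 + ln 2) / e <= ln (ln (n2 k)) by near: k; move/cvgryPge : lln2; exact.
  have h4 : 2 * ln (n2 k) <= expR (- C1 - (- 1 - e) * lnln (n2 k)).
    rewrite -[2 * _](lnK (x := 2 * ln (n2 k))) ?posrE ?mulr_gt0// ler_expR lnM ?posrE// /lnln.
    by move: h3; rewrite ler_pdivrMr//; lra.
  apply: (@le_trans _ _ (expR (2 * ln (n2 k)) * expR (- (2 ^+ k * t)))).
    by rewrite ler_pM2l ?expR_gt0.
  by rewrite -expRD -[leRHS]expR0 ler_expR; lra.
move=> [N _ HN].
have : {ae P, forall w, \forall k \near \oo, ~ [set w | low G lnln (Y w) (- 1 - e) k.+1] w}.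
  apply: (@borel_cantelli_ae _ _ _ P _ _
    (fun k => expR (- 2 * ln (ln 2)) * expR (- ((1 + 1) * ln k.+1%:R)))
    (maxn 1 N) (expR (- 2 * ln (ln 2)) * 1^-1)).
  - by move=> k; exact: measurable_low.
  - move=> k; rewrite geq_max => /andP[k1 Nk].
    have := HN k.+1 (leqW Nk) => /=; rewrite -ler_pdivlMl ?expR_gt0// mulr1 -expRN => h.
    have -> : P [set w | low G lnln (Y w) (- 1 - e) k.+1] =
        (fine (P [set w | low G lnln (Y w) (- 1 - e) k.+1]))%:E.
      by rewrite fineK// fin_num_measure.
    rewrite lee_fin; apply: le_trans h _.
    by rewrite -expRD ler_expR ln_n2S; lra.
  - move=> n; rewrite -mulr_sumr ler_pM2l ?expR_gt0//.
    apply: le_trans (@sum_expRN_ln_le R 1 n ltr01).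
    have [nN|Nn] := leqP n (maxn 1 N).
      by rewrite big_geq// sumr_ge0// => k _; exact: expR_ge0.
    rewrite [leRHS](@big_cat_nat _ _ _ (maxn 1 N))/= ?leq_maxl ?(ltnW Nn)//.
    by rewrite lerDr sumr_ge0// => k _; exact: expR_ge0.
apply: filterS => w [k0 _ H]; exists k0.+1 => // -[//|k] /= k0k.
exact: H.
Unshelve. all: by end_near. Qed.


(** The cycle of index [k] exceeds [G (arg k)] infinitely often, these events being independent.
    Each time it spoils [low] at the next power of 2, since rounding [k.+2] up to it is absorbed by
    the margin [e]. *)
Lemma frequently_not_low_ln (U : R -> R) kappa e : regularly_varying U kappa ->
  (\forall y \near +oo, is_derive (y : R) (1 : R) G (U y)) -> 0 < e ->
  {ae P, forall w, forall N, exists2 k, (N <= k)%N & ~ low G (@ln R) (Y w) (1 - e) k}.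
Proof.
move=> rvU dG e0.
pose arg k : R := ln k.+2%:R + ln (ln k.+2%:R).
have [N0 _ HN0] : \forall k \near \oo, z0 < arg k.
  have k2oo : k.+2%:R @[k --> \oo] --> (+oo : set_system R).
    apply/cvgryPge => A; near=> k; apply: (@le_trans _ _ k%:R).
      by near: k; exact: nbhs_infty_ger.
    by rewrite ler_nat !leqW.
  near=> k; rewrite /arg -[ln (ln _)]mul1r; near: k.
  have lnoo := cvg_comp _ _ k2oo (@cvgy_ln R).
  by move/cvgryPgt : (cvg_comp _ _ lnoo (drift_cvgy (slow_ln R) 1)); exact.
have : {ae P, forall w, forall N, exists2 k, (N <= k)%N & (Z k @^-1` ~` below (G (arg k))) w}.
  apply: (@borel_cantelli2 _ _ _ P _ _ _ (fun k => expR (- C1) * expR (- arg k)) N0).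
  - by move=> k; apply: mpre; exact: measurableC (measurable_below _).
  - move=> J uJ; apply: (indepZ (A := fun k => ~` below (G (arg k)))) => // k.
    exact: measurableC (measurable_below _).
  - by move=> k _; rewrite mulr_ge0 ?expR_ge0.
  - move=> k Nk; rewrite tailE -(tailE 0) -expRD; apply: tail_ge; exact: HN0.
  - by move=> A; apply: sum_inv_nln_unbounded; exact: expR_gt0.
have e1 : 1 - e < 1 by rewrite ltrBlDr ltrDl.
(* Used at [t = k.+2] with [alpha = 1] and [K = 2], as [k.+2] lies between a power of 2 and its
   double. *)
have [N1 _ HN1] := level_shift rvU dG ltr01 (slow_ln R) (ler1n R 2) e1.
apply: filterS => w H N; have [k Nk Ek] := H (2 ^ (maxn N N1))%N.
have k0 : (0 < k.+2)%N by [].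
have /andP[i1 i2] : (2 ^ trunc_log 2 k.+2 <= k.+2 < 2 ^ (trunc_log 2 k.+2).+1)%N.
  exact: trunc_log_bounds.
have ik : (maxn N N1 <= trunc_log 2 k.+2)%N by apply: trunc_log_max => //; rewrite !leqW.
move: ik; rewrite geq_max => /andP[Ni N1i].
exists (trunc_log 2 k.+2).+1; first exact: leqW.
move=> /(_ k) lowk; apply: Ek => /=; rewrite /below /=.
apply: le_trans (lowk _) _; first by apply: ltn_trans i2.
rewrite lee_fin.
have [||] := HN1 (trunc_log 2 k.+2).+1 (leqW N1i) k.+2%:R.
- by rewrite exprS mulrAC divff// mul1r -natrX ler_nat.
- apply: (@le_trans _ _ (2 ^+ (trunc_log 2 k.+2).+1)).
    by rewrite -natrX ler_nat ltnW.
  by rewrite ler_peMl ?exprn_ge0// ler1n.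
by rewrite divr1 mul1r.
Unshelve. all: by end_near. Qed.

Let halves n : \sum_(k < n) 2^-1 ^+ k <= (2 : R).
Proof.
suff : \sum_(k < n) 2^-1 ^+ k <= 2 - 2 * 2^-1 ^+ n :> R.
  move=> h; apply: le_trans h _; rewrite gerBl mulr_ge0// exprn_ge0//.
elim: n => [|n IH]; first by rewrite big_ord0 expr0 mulr1 subrr.
by rewrite big_ord_recr/= exprS; lra.
Qed.

(* With [n_k = 2^(k^2)], the first [n_(k-1)] cycles are too few to exceed the level
   of scale [k^2], while the events that no cycle of index in [[n_(k-1), n_k[] does
   are independent, with probabilities at least [1 / k]. *)
Lemma frequently_low_lnln e : 0 < e ->
  {ae P, forall w, forall N, exists2 k, (N <= k)%N & low G lnln (Y w) (- 1 + e) k}.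
Proof.
move=> e0; pose a := -1 + e; pose nn k := (2 ^ (k ^ 2))%N.
pose arg k := n2 (k ^ 2) + a * lnln (n2 (k ^ 2)).
pose u k := ln (n2 (k ^ 2)).
have nn_mono k l : (k <= l)%N -> (nn k <= nn l)%N.
  by move=> kl; rewrite leq_exp2l// leq_exp2r.
have u_le k : (0 < k)%N -> u k <= 2 * ln k%:R.
  move=> k0; have k0' : 0 < k%:R :> R by rewrite ltr0n.
  rewrite /u /n2 lnXn// -[_ *+ (k ^ 2)]mulr_natl natrX lnM ?posrE ?exprn_gt0 ?ln_gt0 ?ltr1n//.
  rewrite lnXn// -[_ *+ 2]mulr_natl gerDl ln_le0//.
  by apply: (@le_ln1Dx R 1); rewrite (lt_trans _ ltr01)// oppr_lt0.
(* With [u k <= 2 * ln k], the factor 1/4 gives [2 * 2 ^+ (k ^ 2) * tail (arg k) <= ln k]; the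
   leading 2 is the cost of bounding [1 - t] below by [expR (- (2 * t))] for [t <= 2^-1]. *)
have [N _ HN] : \forall k \near \oo, 2 ^+ (k ^ 2) * tail (arg k) <= u k / 4.
  have lln2 : ln (ln (n2 k)) @[k --> \oo] --> (+oo : set_system R).
    exact: (cvg_comp _ _ (cvg_comp _ _ n2oo (@cvgy_ln R)) (@cvgy_ln R)).
  have [N _ HN] : \forall k \near \oo, 2 ^+ k * tail (n2 k + a * lnln (n2 k)) <= ln (n2 k) / 4.
    near=> k.
    have h : 2 ^+ k * tail (n2 k + a * lnln (n2 k)) <= expR (C1 - a * lnln (n2 k)).
      by near: k; exact: scaled_tail_le.
    have u0 : 0 < ln (n2 k).
      by near: k; move/cvgryPgt : (cvg_comp _ _ n2oo (@cvgy_ln R)); exact.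
    have h3 : (C1 + ln 4) / e <= ln (ln (n2 k)) by near: k; move/cvgryPge : lln2; exact.
    apply: le_trans h _.
    rewrite -[_ / 4](lnK (x := ln (n2 k) / 4)) ?posrE ?divr_gt0// ler_expR ln_div ?posrE// /lnln /a.
    by move: h3; rewrite ler_pdivrMr//; lra.
  exists N => // k /= Nk; apply: HN; apply: leq_trans Nk _.
  by rewrite expnS expn1; case: (k) => // k'; rewrite leq_pmulr.
pose B k := index_iota (nn k.-1) (nn k).
have uB k : uniq (B k) by exact: iota_uniq.
have dB k l j : j \in B k -> j \in B l -> k = l.
  rewrite !mem_index_iota => /andP[k1 k2] /andP[l1 l2].
  case: (ltngtP k l) => // kl.
    have : (nn k <= nn l.-1)%N by apply: nn_mono; case: (l) kl.
    by move=> /leq_trans /(_ l1); rewrite leqNgt k2.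
  have : (nn l <= nn k.-1)%N by apply: nn_mono; case: (k) kl.
  by move=> /leq_trans /(_ k1); rewrite leqNgt l2.
pose A k := below (G (arg k)).
have mA k : measurable (A k) by exact: measurable_below.
pose block k := \bigcap_(j in [set` B k]) Z j @^-1` A k.
have io_block : {ae P, forall w, forall N, exists2 k, (N <= k)%N & block k w}.
  apply: (@borel_cantelli2 _ _ _ P _ _ _ (fun k => k.+1%:R^-1) (maxn N 1)).
  - by move=> k; exact: measurable_block.
  - by move=> J; exact: independent_blocks.
  - by move=> k _; rewrite invr_ge0.
  - move=> k; rewrite geq_max => /andP[Nk k0].
    rewrite /block /A prob_all_below ?iota_uniq// lee_fin.
    have /andP[t0 t1] := tail01 (arg k).
    have h := HN k Nk; have uk := u_le k k0.
    have k0' : 0 < k%:R :> R by rewrite ltr0n.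
    have t2 : tail (arg k) <= 2^-1.
      have lnk := ln_sublinear k0'.
      have kk : k%:R <= 2 ^+ (k ^ 2) :> R.
        rewrite -natrX ler_nat ltnW// (leq_trans (ltn_expl k (isT : (1 < 2)%N)))//.
        by rewrite leq_exp2l// expnS expn1 leq_pmulr.
      have kT : k%:R * tail (arg k) <= 2 ^+ (k ^ 2) * tail (arg k) by exact: ler_wpM2r.
      by rewrite -(ler_pM2l k0'); lra.
    have h1 : expR (- (2 * tail (arg k))) <= 1 - tail (arg k).
      have h2 := expR_ge1Dx (2 * tail (arg k)).
      have h3 : expR (2 * tail (arg k)) * expR (- (2 * tail (arg k))) = 1.
        by rewrite -expRD subrr expR0.
      have h4 := expR_gt0 (- (2 * tail (arg k))).
      rewrite -(ler_pM2l (expR_gt0 (2 * tail (arg k)))) h3.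
      have h5 : (1 + 2 * tail (arg k)) * (1 - tail (arg k)) <=
          expR (2 * tail (arg k)) * (1 - tail (arg k)).
        by rewrite ler_wpM2r ?subr_ge0.
      apply: le_trans h5; nra.
    apply: (@le_trans _ _ (expR (- (2 * tail (arg k))) ^+ nn k)).
      rewrite -expRM_natl natrX.
      apply: (@le_trans _ _ (expR (- ln k%:R))).
        by rewrite expRN lnK ?posrE// lef_pV2 ?posrE// ler_nat.
      by rewrite ler_expR; lra.
    apply: (@le_trans _ _ ((1 - tail (arg k)) ^+ nn k)).
      by rewrite lerXn2r ?nnegrE ?expR_ge0 ?subr_ge0.
    by rewrite ler_wiXn2l ?subr_ge0 ?gerBl// size_iota leq_subr.
  - by move=> A0; exact: harmonic_unbounded.
have ev_first : {ae P, forall w, \forall k \near \oo,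
    ~ (~` \bigcap_(j in `I_(nn k)) Z j @^-1` A k.+1) w}.
  apply: (@borel_cantelli_ae _ _ _ P _ _ (fun k => 2^-1 ^+ k) N 2).
  - move=> k; apply: measurableC; apply: bigcap_measurableType => j _; exact: mpre.
  - move=> k Nk; apply: le_trans (prob_not_all_below _ _) _; rewrite lee_fin natrX.
    have h := HN k.+1 (leqW Nk); have uk := u_le k.+1 isT.
    (* Of the gain [2 ^+ (k + k.+1)] between consecutive scales, [2 ^+ k.+1] absorbs the logarithm
       and [2 ^+ k] gives the summable bound. *)
    have kk : (k.+1 ^ 2 = k ^ 2 + k + k.+1)%N by ring.
    have k1 : 0 < k.+1%:R :> R by rewrite ltr0n.
    have lnk := ln_sublinear k1.
    have k2 : k.+1%:R <= 2 ^+ k.+1 :> R by rewrite -natrX ler_nat ltnW// ltn_expl.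
    have p1 : (0 : R) < 2 ^+ k by rewrite exprn_gt0.
    have p2 : (0 : R) < 2 ^+ k.+1 by rewrite exprn_gt0.
    rewrite exprVn -[leRHS]mul1r ler_pdivlMr// -(ler_pM2r p2) mul1r.
    apply: le_trans k2; move: h; rewrite kk !exprD.
    rewrite (_ : _ * tail (arg k.+1) =
      2 ^+ (k ^ 2) * tail (arg k.+1) * 2 ^+ k * 2 ^+ k.+1); last by ring.
    by lra.
  - move=> n; apply: le_trans (halves n).
    have [nN|Nn] := leqP n N.
      by rewrite big_geq// sumr_ge0// => k _; rewrite exprn_ge0.
    rewrite -(big_mkord xpredT (fun k => 2^-1 ^+ k)).
    rewrite [leRHS](@big_cat_nat _ _ _ N)/= ?(ltnW Nn)//.
    by rewrite lerDr sumr_ge0// => k _; rewrite exprn_ge0.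
near=> w => N1.
have [N2 _ HN2] : \forall k \near \oo, ~ (~` \bigcap_(j in `I_(nn k)) Z j @^-1` A k.+1) w.
  by near: w.
have Hio : forall N, exists2 k, (N <= k)%N & block k w by near: w.
have [[//|k]] := Hio (maxn N1 N2).+1; rewrite ltnS geq_max => /andP[N1k N2k] bk.
exists (k.+1 ^ 2)%N.
  by rewrite expnS expn1 (leq_trans (leqW N1k))// leq_pmulr.
move=> j jk; rewrite /level -/(n2 _).
have [jn|nj] := ltnP j (nn k).
  by have /contrapT /(_ j jn) := HN2 k N2k.
by apply: (bk j) => /=; rewrite mem_index_iota nj.
Unshelve. all: by end_near. Qed.

End extremes.

(** * Regenerative processes *)

Section generalized_inverse.
Variables (R : realType) (H : R -> R) (x0 b : R).
Hypothesis H_nd : forall x, x0 < x -> derivable H x 1.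
Hypothesis H_oo : H x @[x --> +oo] --> +oo.
Hypothesis H_bounded : forall x, x <= x0 + 1 -> H x <= b.

(** The bound [b] on the left keeps the set defining [gen_inv H z] above [x0 + 1], so its infimum is
    a genuine one, at a point where [H] is continuous. *)
Lemma gen_invK (z : R) : b < z -> H (gen_inv H z) = z.
Proof.
move=> bz; set D := [set x | z < H x].
have D_lb x : D x -> x0 + 1 <= x.
  move=> Dx; rewrite leNgt; apply/negP => /ltW /H_bounded.
  by rewrite leNgt (lt_trans bz Dx).
have D0 : D !=set0.
  move/cvgryPgt : H_oo => /(_ z) [X [_ HX]].
  by exists (X + 1); apply: HX; rewrite ltrDl.
have Dlb : has_lbound D by exists (x0 + 1) => x /D_lb.
have Dinf : has_inf D by split.
have g_ge : x0 + 1 <= gen_inv H z by apply: lb_le_inf.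
have g_gt : x0 < gen_inv H z by apply: lt_le_trans g_ge; rewrite ltrDl.
have cH : {for gen_inv H z, continuous H}.
  exact/differentiable_continuous/derivable1_diffP/H_nd.
apply/eqP; rewrite eq_le; apply/andP; split; rewrite leNgt; apply/negP => h.
  have [e /= e0 He] : \forall x \near gen_inv H z, z < H x by exact: (cvgr_gt _ cH).
  have Dx : D (gen_inv H z - e / 2).
    by apply: He => /=; rewrite opprB addrC subrK gtr0_norm; lra.
  by have := ge_inf Dlb Dx; rewrite -/(gen_inv H z); lra.
have [e /= e0 He] : \forall x \near gen_inv H z, H x < z by exact: (cvgr_lt _ cH).
have [x Dx xe] := inf_adherent e0 Dinf.
have xg : gen_inv H z <= x by exact: ge_inf.
have : H x < z.
  by apply: He => /=; rewrite distrC ger0_norm; move: xe; rewrite -/(gen_inv H z); lra.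
by rewrite ltNge ltW.
Qed.
End generalized_inverse.

Section cycle.
Variable R : realType.

Lemma measurable_cycle_length : measurable_fun [set: cycle_space R] (fun c => c.1).
Proof.
move=> _ B mB; rewrite setTI; apply: sub_sigma_algebra; left; left.
by exists B => //; rewrite setTI.
Qed.

Lemma measurable_cycle_max :
  measurable_fun [set: cycle_space R] (fun c => running_sup c.2 c.1).
Proof.
move=> _ B mB; rewrite setTI; apply: sub_sigma_algebra; right.
by exists B => //; rewrite setTI.
Qed.
End cycle.

Section regenerative_paths.
Context (R : realType) d (Omega : measurableType d) (P : probability Omega R)
  (X : R -> Omega -> R) (T : nat -> Omega -> R) (xi : nat -> R -> Omega -> R).
Hypothesis hX : regenerative P X T xi.

Let T0 k w : 0 < T k w. Proof. by have [+ _ _ _ _] := hX; exact. Qed.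

Lemma epochS k w : epoch T k.+1 w = epoch T k w + T k w.
Proof. by rewrite /epoch big_ord_recr. Qed.

Lemma epoch_ge0 k w : 0 <= epoch T k w.
Proof. by apply: sumr_ge0 => i _; exact: ltW. Qed.

Lemma epoch_le w : {homo (fun k => epoch T k w) : k l / (k <= l)%N >-> k <= l}.
Proof.
by apply: homo_leq => [//|? ? ?|k]; [exact: le_trans|rewrite epochS lerDl ltW].
Qed.

Let cycle_maximum k w := running_sup (fun s => xi k s w) (T k w).

Let X_cycle k w t : epoch T k w <= t < epoch T k.+1 w -> X t w = xi k (t - epoch T k w) w.
Proof. by have [_ _ _ _ [_]] := hX; exact. Qed.

Lemma running_sup_le_cycles w n t x : t <= epoch T n w ->
  (forall j, (j < n)%N -> (cycle_maximum j w <= x)%E) -> (running_sup (X ^~ w) t <= x)%E.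
Proof.
move=> tn H; apply: ge_ereal_sup => _ [s /= + <-]; rewrite in_itv/= => /andP[s0 st].
have [j jn sj] : exists2 j, (j < n)%N & epoch T j w <= s < epoch T j.+1 w.
  have : s < epoch T n w by exact: lt_le_trans tn.
  elim: n {tn H} => [|n IH sn]; first by rewrite /epoch big_ord0 ltNge s0.
  have [ns|ns] := leP (epoch T n w) s; first by exists n => //; rewrite ns.
  by have [j jn ?] := IH ns; exists j => //; exact: leqW.
apply: le_trans (H j jn); rewrite (X_cycle sj); apply: ereal_sup_ubound.
exists (s - epoch T j w) => //=; rewrite in_itv/=.
by move: sj; rewrite epochS => /andP[? ?]; apply/andP; split; lra.
Qed.

Lemma running_sup_ge_cycle w n t j : epoch T n w <= t -> (j < n)%N ->
  (cycle_maximum j w <= running_sup (X ^~ w) t)%E.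
Proof.
move=> nt jn; apply: ge_ereal_sup => _ [s /= + <-]; rewrite in_itv/= => /andP[s0 st].
apply: ereal_sup_ubound; exists (epoch T j w + s) => /=.
  rewrite in_itv/= addr_ge0 ?epoch_ge0//=; apply: lt_le_trans nt.
  have := epoch_le w jn; apply: lt_le_trans; rewrite epochS ltrD2l; exact: st.
rewrite (@X_cycle j) ?[_ + s]addrC ?addrK// [s + _]addrC epochS ltrD2l st andbT.
by rewrite lerDl.
Qed.

Lemma running_sup_first_cycle w : running_sup (X ^~ w) (T 0 w) = cycle_maximum 0 w.
Proof.
have e1 : epoch T 1 w = T 0 w by rewrite epochS /epoch big_ord0 add0r.
apply/eqP; rewrite eq_le; apply/andP; split.
  by apply: (@running_sup_le_cycles _ 1); rewrite ?e1// => -[].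
by apply: (@running_sup_ge_cycle _ 1); rewrite ?e1.
Qed.

End regenerative_paths.

Section cycle_tail.
Context (R : realType) d (Omega : measurableType d) (P : probability Omega R)
  (X : R -> Omega -> R) (T : nat -> Omega -> R) (xi : nat -> R -> Omega -> R).
Hypothesis hX : regenerative P X T xi.
Variables (r : R -> R).
Hypothesis hr : forall x, log_tail P X T x = (r x)%:E.

Let M (c : cycle_space R) := running_sup c.2 c.1.

Lemma cycle_tailE x : P (regen_cycle T xi 0 @^-1` ~` below M x) = (expR (- r x))%:E.
Proof.
have mZ : measurable_fun setT (regen_cycle T xi 0) by have [_ + _ _ _] := hX; exact.
have mb : measurable (regen_cycle T xi 0 @^-1` below M x).
  rewrite -[X in measurable X]setTI; apply: mZ => //.
  by apply: measurable_below; exact: measurable_cycle_max.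
have cdfE : cycle_max_cdf P X T x = P (regen_cycle T xi 0 @^-1` below M x).
  rewrite /cycle_max_cdf; congr (P _); apply/seteqP; split => w /=;
  by rewrite (running_sup_first_cycle hX).
have := hr x; rewrite /log_tail cdfE -probability_setC// preimage_setC.
set q := P _ => hq.
have qE : q = (fine q)%:E.
  by rewrite fineK// fin_num_measure//; rewrite -preimage_setC; exact: measurableC.
have q0 : 0 <= fine q by apply: fine_ge0; exact: measure_ge0.
(* A zero tail would make [log_tail] infinite, whereas [hr] gives it a real value. *)
move: hq; rewrite qE; have [->|qn0] := eqVneq (fine q) 0.
  by rewrite le0_lneNy.
have qp : 0 < fine q by rewrite lt_neqAle eq_sym qn0.
by rewrite lne_EFin// -EFinN => -[<-]; rewrite opprK lnK ?posrE.
Qed.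

Lemma cycle_tail_nd x y : x <= y -> r x <= r y.
Proof.
move=> xy; have mZ : measurable_fun setT (regen_cycle T xi 0) by have [_ + _ _ _] := hX; exact.
have mb z : measurable (regen_cycle T xi 0 @^-1` ~` below M z).
  rewrite -[X in measurable X]setTI; apply: mZ => //.
  by apply: measurableC; apply: measurable_below; exact: measurable_cycle_max.
rewrite -lerN2 -ler_expR -lee_fin -!cycle_tailE; apply: le_measure; rewrite ?inE//.
move=> w /= h1 h2; apply: h1; rewrite /below /= in h2 *.
by apply: le_trans h2 _; rewrite lee_fin.
Qed.
End cycle_tail.

Theorem theorem1 (R : realType) (d : measure_display)
    (Omega : measurableType d) (P : probability Omega R)
    (X : R -> Omega -> R) (T : nat -> Omega -> R)
    (xi : nat -> R -> Omega -> R)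
    (hX : regenerative P X T xi)
    (R0 R1 : R -> R)
    (hR : forall x, log_tail P X T x = (R0 x + R1 x)%:E)
    (C1 : R) (hR1 : forall x, `|R1 x| <= C1)
    (hR0 : condU R0)
    (hT : ('E_P[T 0%N] < +oo)%E) :
  let alphaT : R := fine 'E_P[T 0%N]%E in
  let r0 : R -> R := derive1 R0 in
  let A0 : R -> R := fun t => gen_inv R0 (ln (t / alphaT)) in
  let Xbar : R -> Omega -> \bar R := fun t w => running_sup (X ^~ w) t in
  {ae P, forall w,
     limf_esup (fun t : R =>
       (r0 (A0 t))%:E * (Xbar t w - (A0 t)%:E) / (ln (ln t))%:E)%E
       (pinfty_nbhs R) = 1%E} /\
  {ae P, forall w,
     limf_einf (fun t : R =>
       (r0 (A0 t))%:E * (Xbar t w - (A0 t)%:E) / (ln (ln (ln t)))%:E)%E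
       (pinfty_nbhs R) = (- 1)%E}.
Proof.
move=> alphaT r0 A0 Xbar.
have [T0 mZ indepZ identZ _] := hX.
have [R0oo [x0 [_ R0d]] dG [kappa rvU]] := hR0.
pose Z := regen_cycle T xi.
pose M (c : cycle_space R) := running_sup c.2 c.1.
have mM : measurable_fun setT M by exact: measurable_cycle_max.
have mT0 : measurable_fun setT (T 0).
  exact: (measurableT_comp (@measurable_cycle_length R) (mZ 0)).
have alpha0 : 0 < alphaT.
  rewrite /alphaT unlock fine_gt0// integral_gt0//=.
  by move: hT; rewrite unlock.
(* The absolute value makes [tau] nonnegative on all of [cycle_space R], which contains pairs with
   negative first component. *)
pose tau (c : cycle_space R) := `|c.1|.
have mtau : measurable_fun setT tau.
  by apply: measurableT_comp => //; exact: measurable_cycle_length.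
have tauE k w : tau (Z k w) = T k w by exact: gtr0_norm (T0 k w).
have [c [C [c0 C0 growth]]] : exists c C : R, [/\ 0 < c, 0 < C &
    {ae P, forall w, \forall k \near \oo,
    c * 2 ^+ k <= \sum_(i < 2 ^ k) tau (Z i w) <= C * 2 ^+ k}].
  apply: (@linear_growth _ _ _ _ _ P Z tau) => //.
  - by move=> x; exact: normr_ge0.
  - by move=> w; rewrite tauE.
  - move: hT; rewrite unlock; congr (_ < _)%E.
    by apply: eq_integral => w _; rewrite tauE.
have tailE := cycle_tailE hX hR.
have tail_nd := cycle_tail_nd hX hR.
have R1b x : - C1 <= R1 x <= C1 by rewrite -ler_norml.
(* Monotonicity of [R0 + R1] gives this bound far to the left, where [condU] says nothing about
   [R0]; each replacement of [R1] by a constant costs [C1]. *)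
have R0le x : x <= x0 + 1 -> R0 x <= R0 (x0 + 1) + C1 + C1.
  by move=> /tail_nd; have := R1b x; have := R1b (x0 + 1); lra.
have R0K := gen_invK R0d R0oo R0le.
set z0 := R0 (x0 + 1) + C1 + C1 in R0K.
have tail_ge z : z0 < z ->
    ((expR (- C1 - z))%:E <= P (Z 0%N @^-1` ~` below M (gen_inv R0 z)))%E.
  move=> /R0K zK; rewrite tailE zK lee_fin ler_expR.
  by have := R1b (gen_inv R0 z); lra.
have tail_le z : z0 < z ->
    (P (Z 0%N @^-1` ~` below M (gen_inv R0 z)) <= (expR (C1 - z))%:E)%E.
  move=> /R0K zK; rewrite tailE zK lee_fin ler_expR.
  by have := R1b (gen_inv R0 z); lra.
pose Y w j := M (Z j w).
have r0E t : r0 (A0 t) = (hhat R0 (ln (t / alphaT)))^-1 by rewrite /hhat invrK.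
have supE m w : scaled_sup (gen_inv R0) (hhat R0) alphaT m (Xbar ^~ w) =
    (fun t => (r0 (A0 t))%:E * (Xbar t w - (A0 t)%:E) / (m (ln t))%:E)%E.
  by apply/funext => t; rewrite r0E.
have ev_growth : {ae P, forall w, (\forall k \near \oo, c * 2 ^+ k <= epoch T (2 ^ k) w) /\
    (\forall k \near \oo, epoch T (2 ^ k) w <= C * 2 ^+ k)}.
  apply: filterS growth => w H.
  have H' : \forall k \near \oo, c * 2 ^+ k <= epoch T (2 ^ k) w <= C * 2 ^+ k.
    apply: filterS H => k; rewrite /epoch.
    by under eq_bigr do rewrite tauE.
  by split; apply: filterS H' => k /andP[].
have inv_gt0 n : 0 < n.+1%:R^-1 :> R by rewrite invr_gt0.
split.
  have low1 : {ae P, forall w, forall n, \forall k \near \oo,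
      low (gen_inv R0) (@ln R) (Y w) (1 + n.+1%:R^-1) k}.
    by apply: ae_foralln => n; exact: (eventually_low_ln mZ identZ mM tail_le).
  have low2 : {ae P, forall w, forall n N, exists2 k, (N <= k)%N &
      ~ low (gen_inv R0) (@ln R) (Y w) (1 - n.+1%:R^-1) k}.
    apply: ae_foralln => n.
    exact: (frequently_not_low_ln mZ indepZ identZ mM tail_ge rvU dG).
  apply: filterS3 ev_growth low1 low2 => w [g1 g2] l1 l2.
  rewrite -(supE (@ln R) w).
  apply: (limsup_scaled_sup (S := fun n => epoch T n w)
    rvU dG alpha0 (slow_ln R) _ _ c0 C0 g1 g2 l1 l2).
  - by move=> n t x tn H; exact: (running_sup_le_cycles hX tn H).
  - by move=> n t j tn jn; exact: (running_sup_ge_cycle hX tn jn).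
have sl := slow_ln_comp (slow_ln R).
have low1 : {ae P, forall w, forall n, \forall k \near \oo,
    ~ low (gen_inv R0) (fun y => ln (ln y)) (Y w) (- 1 - n.+1%:R^-1) k}.
  by apply: ae_foralln => n; exact: (eventually_not_low_lnln mZ indepZ identZ mM tail_ge).
have low2 : {ae P, forall w, forall n N, exists2 k, (N <= k)%N &
    low (gen_inv R0) (fun y => ln (ln y)) (Y w) (- 1 + n.+1%:R^-1) k}.
  by apply: ae_foralln => n; exact: (frequently_low_lnln mZ indepZ identZ mM tail_le).
apply: filterS3 ev_growth low1 low2 => w [g1 g2] l1 l2.
rewrite -(supE (fun y => ln (ln y)) w).
apply: (liminf_scaled_sup (S := fun n => epoch T n w) rvU dG alpha0 sl _ _ c0 C0 g1 g2 l1 l2).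
- by move=> n t x tn H; exact: (running_sup_le_cycles hX tn H).
- by move=> n t j tn jn; exact: (running_sup_ge_cycle hX tn jn).
Qed.
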